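(* Let $\{X_n,n\ge 1\}$ be a strictly stationary sequence of real random variables with marginal distribution function $F$, and let $a_n>0$, $b_n\in\mathbb{R}$ be constants. Suppose: (a) for all $x,y\in\mathbb{R}$, with $u_n=a_n^{-1}x+b_n$ and $v_n=a_n^{-1}y+b_n$, the sequence $\{X_n\}$ satisfies Condition $D(u_n,v_n)$ and Condition $D'(u_n)$; (b) there is a non-degenerate distribution function $G$ with $\lim_{n\to\infty}F^n(a_n^{-1}x+b_n)=G(x)$ for every continuity point $x$ of $G$; (c) $\boldsymbol{\varepsilon}=\{\varepsilon_n,n\ge1\}$ is a sequence of Bernoulli ($\{0,1\}$-valued) random variables, independent of $\{X_n,n\ge 1\}$, such that, with $S_n=\sum_{k=1}^n\varepsilon_k$, $S_n/n\to\lambda$ in probability as $n\to\infty$, for some random variable $\lambda$ with $\lambda\in[0,1]$ a.s. Let $\{\widehat{X}_n,n\ge1\}$ be a copy (in law) of $\{X_n,n\ge1\}$ independent of $(\{X_n\},\boldsymbol{\varepsilon})$, and put $X_n(\boldsymbol{\varepsilon})=\varepsilon_nX_n+(1-\varepsilon_n)\widehat{X}_n$, $M_n(X)=\max_{1\le k\le n}X_k$, $M_n(X(\boldsymbol{\varepsilon}))=\max_{1\le k\le n}X_k(\boldsymbol{\varepsilon})$. Then for any $x,y\in\mathbb{R}$, $$\lim_{n\to\infty}P\left[M_n(X(\boldsymbol{\varepsilon}))\le a_n^{-1}x+b_n,\ M_n(X)\le a_n^{-1}y+b_n\right]=G(\min\{x,y\})\,E\left[G^{1-\lambda}(\max\{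x,y\})\right].$$
   Context: The variables $\varepsilon_n$ need be neither independent nor identically distributed. $G^{1-\lambda}(z)$ means $G(z)^{1-\lambda}$ (with $0^0=1$). Condition $D(u_n,v_n)$ for a strictly stationary sequence $\{X_n\}$ and real sequences $u_n,v_n$: there are numbers $\alpha_{n,l}$ such that for all $n,l$ and all $A_1,A_2,B_1,B_2\subset\{1,\dots,n\}$ with $A_1\cap A_2=\emptyset$, $B_1\cap B_2=\emptyset$ and $\min_{a\in A_1\cup A_2,\,b\in B_1\cup B_2}|b-a|\ge l$, $$\Big|P\Big[\bigcap_{j\in A_1\cup B_1}\{X_j\le u_n\}\cap\bigcap_{j\in A_2\cup B_2}\{X_j\le v_n\}\Big]-P\Big[\bigcap_{j\in A_1}\{X_j\le u_n\}\cap\bigcap_{j\in A_2}\{X_j\le v_n\}\Big]P\Big[\bigcap_{j\in B_1}\{X_j\le u_n\}\cap\bigcap_{j\in B_2}\{X_j\le v_n\}\Big]\Big|\le\alpha_{n,l},$$ and $\alpha_{n,l_n}\to0$ as $n\to\infty$ for some $l_n=o(n)$. Condition $D'(u_n)$: $\lim_{k\to\infty}\limsup_{n\to\infty}n\sum_{j=2}^{\lfloor n/k\rfloor}P[X_1>u_n,X_j>u_n]=0$. *)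

(* Defs.v *)
From HB Require Import structures.
From mathcomp Require Import all_boot all_order all_algebra.
From mathcomp Require Import all_classical all_reals all_analysis.

Set Implicit Arguments.
Unset Strict Implicit.
Unset Printing Implicit Defensive.

Import Order.TTheory GRing.Theory Num.Theory.
Import numFieldNormedType.Exports.

Local Open Scope classical_set_scope.
Local Open Scope ring_scope.

(* Sequences of random variables are indexed from 0: [X i] is the variable
   usually written X_{i+1}, so that [i < n] ranges over the first n terms. *)

(* [T] is an arbitrary type, so that this also covers the cylinder
   sigma-algebra of R^nat, generated by the coordinate maps. *)
Definition sigma_gen (R : realType) (I T : Type) (Y : I -> T -> R) :
    set (set T) :=
  <<s \bigcup_i preimage_set_system setT (Y i) (@measurable _ R) >>.

Definition cylinder_sigma (R : realType) : set (set (nat -> R)) :=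
  sigma_gen (fun (i : nat) (f : nat -> R) => f i).

Section processes.
Context d (T : measurableType d) (R : realType) (P : probability T R).

Definition same_law (X Y : nat -> {RV P >-> R}) : Prop :=
  forall B : set (nat -> R), cylinder_sigma B ->
    P ((fun w i => X i w) @^-1` B) = P ((fun w i => Y i w) @^-1` B).

Definition strictly_stationary (X : nat -> {RV P >-> R}) : Prop :=
  forall h : nat, same_law (fun i => X (i + h)%N) X.

Definition indep_sigma (A B : set (set T)) : Prop :=
  forall E F : set T, A E -> B F -> (P (E `&` F) = P E * P F)%E.

Definition indep_seq (X Y : nat -> {RV P >-> R}) : Prop :=
  indep_sigma (sigma_gen (fun i => X i)) (sigma_gen (fun i => Y i)).

(* Z is independent of the pair (X, Y). *)
Definition indep_seq_pair (Z X Y : nat -> {RV P >-> R}) : Prop :=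
  indep_sigma (sigma_gen (fun i => Z i))
    <<s sigma_gen (fun i => X i) `|` sigma_gen (fun i => Y i) >>.

Definition cvg_in_probability (Y : nat -> T -> R) (Z : T -> R) : Prop :=
  forall e : R, 0 < e ->
    P [set w | e <= `|Y n w - Z w|] @[n --> \oo] --> 0%E.

Definition partial_sum (Y : nat -> T -> R) (n : nat) (w : T) : R :=
  \sum_(i < n) Y i w.

(* The default value [Y 0 w] only matters for n = 0. *)
Definition running_max (Y : nat -> T -> R) (n : nat) (w : T) : R :=
  \big[Num.max/Y 0%N w]_(i < n) Y i w.

Definition switched (e X X' : nat -> {RV P >-> R}) (n : nat) (w : T) : R :=
  e n w * X n w + (1 - e n w) * X' n w.

Definition below (X : nat -> {RV P >-> R}) (n : nat) (A : {set 'I_n}) (u : R) :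
    set T :=
  [set w | forall j : 'I_n, j \in A -> X j w <= u].

Definition condD (X : nat -> {RV P >-> R}) (u v : nat -> R) : Prop :=
  exists alpha : nat -> nat -> R,
    (forall (n l : nat) (A1 A2 B1 B2 : {set 'I_n}),
        A1 :&: A2 = finset.set0 -> B1 :&: B2 = finset.set0 ->
        (forall a b : 'I_n, a \in A1 :|: A2 -> b \in B1 :|: B2 ->
           (l <= `|(a : nat) - (b : nat)|)%N) ->
        (`| P (below X (A1 :|: B1) (u n) `&` below X (A2 :|: B2) (v n))
            - P (below X A1 (u n) `&` below X A2 (v n))
              * P (below X B1 (u n) `&` below X B2 (v n)) |
         <= (alpha n l)%:E)%E) /\
    (exists l : nat -> nat,
        (l n)%:R / n%:R @[n --> \oo] --> (0 : R) /\
        alpha n (l n) @[n --> \oo] --> 0).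

(* With indices from 0, the sum over 2 <= j <= floor (n / k) becomes
   1 <= j < n %/ k. *)
Definition condD' (X : nat -> {RV P >-> R}) (u : nat -> R) : Prop :=
  limn_esup (fun n : nat =>
     n%:R%:E * \sum_(1 <= j < n %/ k)
                  P [set w | (u n < X 0%N w)%R /\ (u n < X j w)%R])%E
    @[k --> \oo] --> 0%E.

End processes.

Definition nondegenerate_df (R : realType) (G : R -> R) : Prop :=
  ~ exists c : R, forall x : R, G x = (c <= x)%R%:R.

(* Main.v *)
Require Import Defs.
From HB Require Import structures.
From mathcomp Require Import all_boot all_order all_algebra.
From mathcomp Require Import all_classical all_reals all_analysis.
From mathcomp Require Import measurable_realfun zify ring lra.

Set Implicit Arguments.
Unset Strict Implicit.
Unset Printing Implicit Defensive.

Import Order.TTheory GRing.Theory Num.Theory.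
Import numFieldNormedType.Exports.

Local Open Scope classical_set_scope.
Local Open Scope ring_scope.

(** Conditionally on [eps], with [A] the set of [i < n] such that [eps i = 1], the
    event says that [X i] stays below [min u v] for [i] in [A] and below [v] for
    the other [i], and that [X' i] stays below [u] outside [A].  A blocking
    argument shows that, under D and D', the probability of staying below such
    mixed levels differs from the exponential of minus the expected number of
    exceedances by an error that is uniform in [A]: full blocks of length
    [n / k] are asymptotically independent by D (after dropping the last [l]
    indices of the past), and inside one block Bonferroni's inequalities reduce
    the error to the pair exceedances controlled by D'.  Uniformity in [A] makes
    the joint law of [eps] irrelevant; the two factors multiply to a function of
    [#|A| / n], which tends to [lambda] in probability.

    The convergence [F^n -> G] is given at continuity points only.  If [G] jumped
    over a level, comparing the norming constants at times [p n] and [q n] would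
    produce jumps of [G] over every level in (0,1), so [G] would be degenerate;
    hence [G] is continuous.  Points where [G] vanishes follow by monotonicity. *)

(** * Elementary bounds on the exponential at negative arguments *)

Section exponential_bounds.
Context {R : realType}.
Implicit Types p s t : R.

Lemma expRN_ge p : 1 - p <= expR (- p).
Proof. by rewrite -[_ - p]/(1 + - p) expR_ge1Dx. Qed.

(** Here [expR p >= 1 + p], and [(1 - p + p ^+ 2) (1 + p) = 1 + p ^+ 3] is at least 1. *)
Lemma expRN_le_sqr p : 0 <= p -> expR (- p) <= 1 - p + p ^+ 2.
Proof.
move=> p0; have h := expR_ge1Dx p; rewrite expRN.
have e0 := expR_gt0 p.
rewrite -div1r ler_pdivrMr//.
have q0 : 0 <= 1 - p + p ^+ 2 by nra.
apply: le_trans (ler_wpM2l q0 h).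
by rewrite expr2; nra.
Qed.

Lemma expRN_lip s t : 0 <= s -> 0 <= t ->
  `|expR (- s) - expR (- t)| <= `|s - t|.
Proof.
wlog st : s t / s <= t => [H s0 t0|s0 t0].
  case: (leP s t) => [/H|/ltW/H]; first by apply.
  by rewrite distrC (distrC s); apply.
have e1 : expR (- s) <= 1 by rewrite expR_le1 oppr_le0.
have est : expR (- t) <= expR (- s) by rewrite ler_expR lerN2.
rewrite ger0_norm ?subr_ge0// ler0_norm ?subr_le0//.
have -> : - t = - s + - (t - s) by ring.
rewrite expRD; have := expRN_ge (t - s); have := expR_gt0 (- s).
by nra.
Qed.

End exponential_bounds.

(** * Probabilities as real numbers *)

Section real_probability.
Context d (T : measurableType d) (R : realType) (P : probability T R).

Definition pr (A : set T) : R := fine (P A).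

Lemma prE A : measurable A -> P A = (pr A)%:E.
Proof. by move=> mA; rewrite /pr fineK// fin_num_measure. Qed.

Lemma pr_ge0 A : 0 <= pr A.
Proof. by rewrite fine_ge0. Qed.

Lemma pr_setT : pr setT = 1.
Proof. by rewrite /pr probability_setT. Qed.

Lemma le_pr A B : measurable A -> measurable B -> A `<=` B -> pr A <= pr B.
Proof. by move=> mA mB AB; rewrite fine_le ?fin_num_measure// le_measure ?inE. Qed.

Lemma pr_le1 A : measurable A -> pr A <= 1.
Proof. by move=> mA; rewrite -pr_setT le_pr. Qed.

Lemma pr_setDI A B : measurable A -> measurable B ->
  pr (A `\` B) = pr A - pr (A `&` B).
Proof.
move=> mA mB; have mD := measurableD mA mB; have mI := measurableI _ _ mA mB.
apply/eqP; rewrite eq_sym subr_eq; apply/eqP/EFin_inj.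
rewrite EFinD -!prE// -[in LHS](setUIDK A B) measureU//; first by rewrite addeC.
by apply/seteqP; split=> // w [[_ ?] [_]].
Qed.

End real_probability.

(** * Avoidance of a range of events and Bonferroni's inequalities *)

Section avoidance.
Context d (T : measurableType d) (R : realType) (P : probability T R).
Variables (B : nat -> set T) (mB : forall j, measurable (B j)).
Local Notation pr := (pr P).

Definition avoid (s e : nat) : set T := [set w | forall j, (s <= j < e)%N -> ~ B j w].

Lemma avoid_empty s e : (e <= s)%N -> avoid s e = setT.
Proof.
move=> es; apply/seteqP; split=> // w _ j /andP[sj je].
by have := leq_ltn_trans sj je; rewrite ltnNge es.
Qed.

Lemma avoidS s e : (s <= e)%N -> avoid s e.+1 = avoid s e `\` B e.
Proof.
move=> se; apply/seteqP; split=> w.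
  move=> h; split; last by apply: h; rewrite se ltnSn.
  by move=> j /andP[sj je]; apply: h; rewrite sj ltnW.
move=> [h ne] j /andP[sj]; rewrite ltnS leq_eqVlt => /orP[/eqP->//|je].
by apply: h; rewrite sj.
Qed.

Lemma avoid_cat r s e : (r <= s)%N -> (s <= e)%N ->
  avoid r s `&` avoid s e = avoid r e.
Proof.
move=> rs se; apply/seteqP; split=> w.
  move=> [h1 h2] j /andP[rj je]; case: (ltnP j s) => js.
    by apply: h1; rewrite rj.
  by apply: h2; rewrite js.
move=> h; split=> j /andP[h1 h2]; apply: h.
  by rewrite h1 (leq_trans h2).
by rewrite h2 (leq_trans rs).
Qed.

Lemma measurable_avoid s e : measurable (avoid s e).
Proof.
elim: e => [|e IH]; first by rewrite avoid_empty.
case: (leqP s e) => se; last by rewrite avoid_empty.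
by rewrite avoidS//; exact: measurableD.
Qed.
Hint Resolve measurable_avoid : core.

(** The union bound, removing one event at a time. The extra [A] lets it serve inside [B e] for the
    second-order inequality, and inside a past avoidance event when indices are dropped. *)
Lemma pr_avoid_ge A s e : measurable A ->
  pr A - \sum_(s <= j < e) pr (A `&` B j) <= pr (A `&` avoid s e).
Proof.
move=> mA; elim: e => [|e IH].
  by rewrite avoid_empty// setIT big_geq// subr0.
case: (leqP s e) => se; last by rewrite avoid_empty// setIT big_geq// subr0.
rewrite avoidS// setIDA pr_setDI//; last exact: measurableI.
rewrite big_nat_recr//= opprD addrA lerB//.
apply: le_pr; [|exact: measurableI|by move=> w [[]]].
by apply: measurableI => //; exact: measurableI.
Qed.

(** Adding the index [e] removes the part of [B e] inside [avoid s e], whose probability the union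
    bound inside [B e] estimates from below. *)
Lemma pr_avoid_le s e : pr (avoid s e) <=
  1 - \sum_(s <= j < e) pr (B j) + \sum_(s <= j < e) \sum_(s <= i < j) pr (B i `&` B j).
Proof.
elim: e => [|e IH].
  by rewrite avoid_empty// !big_geq// pr_setT subr0 addr0.
case: (leqP s e) => se.
  rewrite avoidS// pr_setDI// !(big_nat_recr e)//=.
  have := pr_avoid_ge s e (mB e); rewrite [B e `&` avoid _ _]setIC => h.
  under [X in _ <= _ + (_ + X)]eq_bigr do rewrite setIC.
  lra.
by rewrite avoid_empty// !big_geq// pr_setT subr0 addr0.
Qed.

End avoidance.

(** * Blocking under mixing *)

Section blocks.
Context d (T : measurableType d) (R : realType) (P : probability T R).
Variables (B : nat -> set T) (mB : forall j, measurable (B j)).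
Variables (t : R) (c : nat -> R).
Hypothesis Bt : forall j, pr P (B j) <= t.
Hypothesis Bc : forall i j, (i < j)%N -> pr P (B i `&` B j) <= c (j - i).
Local Notation pr := (pr P).
Local Notation avoid := (avoid B).

Let c_ge0 j : (0 < j)%N -> 0 <= c j.
Proof. by move=> j0; rewrite -[j]subn0 (le_trans (pr_ge0 P _) (Bc j0)). Qed.

Let t_ge0 : 0 <= t.
Proof. exact: le_trans (pr_ge0 P _) (Bt 0). Qed.

Lemma sum_pr_ge0 s e : 0 <= \sum_(s <= j < e) pr (B j).
Proof. by apply: sumr_ge0 => j _; exact: pr_ge0. Qed.

Lemma sum_pr_le s e : \sum_(s <= j < e) pr (B j) <= (e - s)%:R * t.
Proof.
rewrite -[leRHS]/((e - s)%:R * t) mulr_natl -sumr_const_nat.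
exact: ler_sum.
Qed.

(** For fixed [j] the lags [j - i] run once through 1 up to [j - s], which is below [m]; the lags
    added on the right have nonnegative [c]. *)
Let lag_sum s m : \sum_(s <= j < s + m) \sum_(s <= i < j) c (j - i) <=
  m%:R * \sum_(1 <= j < m) c j.
Proof.
rewrite -[m in m%:R](addKn s) mulr_natl -sumr_const_nat.
rewrite big_nat_cond [leRHS]big_nat_cond; apply: ler_sum => j /andP[/andP[sj jm] _].
rewrite big_nat_rev/= -{1}[s]add0n big_addn.
rewrite [leRHS](big_cat_nat (n := (j - s).+1))//=; last by lia.
rewrite big_add1/= -[leLHS]addr0 lerD//.
  rewrite big_nat_cond [leRHS]big_nat_cond; apply: ler_sum => i /andP[/andP[_ ij] _].
  by rewrite (_ : (j - _ = i.+1)%N)//; lia.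
rewrite big_nat_cond; apply: sumr_ge0 => i /andP[/andP[ji _] _].
by apply: c_ge0; lia.
Qed.

(** With [q] the sum of the probabilities, both quantities are at least [1 - q]; the first exceeds
    it by at most the pair terms, the second by at most [q ^+ 2]. *)
Lemma block_estimate s m :
  `|pr (avoid s (s + m)) - expR (- \sum_(s <= j < s + m) pr (B j))| <=
  m%:R * \sum_(1 <= j < m) c j + (m%:R * t) ^+ 2.
Proof.
set q := \sum_(s <= j < s + m) pr (B j).
have q0 : 0 <= q by exact: sum_pr_ge0.
have qt : q <= m%:R * t by rewrite (le_trans (sum_pr_le _ _))// addKn.
have q2 : q ^+ 2 <= (m%:R * t) ^+ 2 by rewrite lerXn2r ?nnegrE// (le_trans q0).
have h1 := pr_avoid_ge P mB s (s + m) measurableT.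
have h2 := pr_avoid_le P mB s (s + m).
have h3 : \sum_(s <= j < s + m) \sum_(s <= i < j) pr (B i `&` B j) <=
    m%:R * \sum_(1 <= j < m) c j.
  apply: le_trans (lag_sum s m); apply: ler_sum => j _.
  rewrite big_nat_cond [leRHS]big_nat_cond.
  by apply: ler_sum => i /andP[/andP[_ ij] _]; exact: Bc.
move: h1; rewrite setTI pr_setT; under eq_bigr do rewrite setTI.
rewrite -/q => h1; rewrite -/q in h2.
have e1 := expRN_ge q; have e2 := expRN_le_sqr q0.
have h4 : 0 <= m%:R * \sum_(1 <= j < m) c j.
  rewrite mulr_ge0// big_nat_cond.
  by apply: sumr_ge0 => i /andP[/andP[i1 _] _]; exact: c_ge0.
rewrite ler_norml; apply/andP; split; lra.
Qed.

(** Each index given up costs at most [t]. This pays for the gap that mixing needs and for the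
    indices left over after division into blocks. *)
Lemma avoid_shorten A s e : measurable A -> (s <= e)%N ->
  `|pr (A `&` avoid 0 e) - pr (A `&` avoid 0 s)| <= (e - s)%:R * t.
Proof.
move=> mA se; have mI j : measurable (A `&` avoid 0 j).
  by apply: measurableI => //; exact: measurable_avoid.
rewrite ler0_norm ?opprB.
  rewrite -(avoid_cat B (leq0n s) se) setIA.
  have := pr_avoid_ge P mB s e (mI s).
  have : \sum_(s <= j < e) pr (A `&` avoid 0 s `&` B j) <= (e - s)%:R * t.
    apply: le_trans (sum_pr_le s e); apply: ler_sum => j _.
    by apply: le_pr => //; exact: measurableI.
  lra.
rewrite subr_le0 le_pr// -(avoid_cat B (leq0n s) se) setIA.
exact: subIsetl.
Qed.

Variables (n l : nat) (alpha : R).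
Hypothesis alpha_ge0 : 0 <= alpha.
Hypothesis mix : forall s e f, (s + l <= e)%N -> (f <= n)%N ->
  `|pr (avoid 0 s `&` avoid e f) - pr (avoid 0 s) * pr (avoid e f)| <= alpha.

(** Mixing needs a gap of length [l], and adjacent blocks have none. The last [l] indices before [s]
    are dropped, mixing is applied, and they are restored; the two changes cost [l%:R * t] each. *)
Lemma avoid_product s f : (s <= f)%N -> (f <= n)%N ->
  `|pr (avoid 0 f) - pr (avoid 0 s) * pr (avoid s f)| <= 2 * l%:R * t + alpha.
Proof.
move=> sf fn; rewrite -(avoid_cat B (leq0n s) sf).
set r := (s - l)%N; have rs : (r <= s)%N by rewrite leq_subr.
have mf := measurable_avoid mB s f.
have rl : (s - r)%:R * t <= l%:R * t by rewrite ler_wpM2r// ler_nat /r; lia.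
have h1 := avoid_shorten mf rs.
have h2 := avoid_shorten measurableT rs; rewrite !setTI in h2.
have h3 : `|pr (avoid 0 r `&` avoid s f) - pr (avoid 0 r) * pr (avoid s f)| <= alpha.
  have [ls|sl] := leqP l s; first by apply: mix => //; rewrite subnK.
  (* The past is shorter than the gap, so nothing remains of it and the product formula is exact. *)
  have -> : r = 0%N by rewrite /r; lia.
  by rewrite avoid_empty// setTI pr_setT mul1r subrr normr0.
have p0 := pr_ge0 P (avoid s f); have p1 := pr_le1 P mf.
rewrite (setIC _ (avoid 0 s)) (setIC _ (avoid 0 r)) in h1.
have h4 : `|(pr (avoid 0 r) - pr (avoid 0 s)) * pr (avoid s f)| <= l%:R * t.
  rewrite normrM (ger0_norm p0) -[leRHS]mulr1 distrC ler_pM//.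
  exact: le_trans h2 rl.
have -> : pr (avoid 0 s `&` avoid s f) - pr (avoid 0 s) * pr (avoid s f) =
  (pr (avoid 0 s `&` avoid s f) - pr (avoid 0 r `&` avoid s f)) +
  (pr (avoid 0 r `&` avoid s f) - pr (avoid 0 r) * pr (avoid s f)) +
  (pr (avoid 0 r) - pr (avoid 0 s)) * pr (avoid s f) by ring.
apply: le_trans (ler_normD _ _) _; apply: le_trans (lerD (ler_normD _ _) h4) _.
have h5 := le_trans h1 rl.
apply: le_trans (lerD (lerD h5 h3) (lexx _)) _.
lra.
Qed.

(** All factors lie in [0,1], so errors add: each further block contributes one decoupling error and
    one in-block error. *)
Let avoid_blocks m i : (i * m <= n)%N ->
  `|pr (avoid 0 (i * m)) - expR (- \sum_(0 <= j < i * m) pr (B j))| <=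
  i%:R * (2 * l%:R * t + alpha +
          (m%:R * \sum_(1 <= j < m) c j + (m%:R * t) ^+ 2)).
Proof.
elim: i => [_|i IH imn].
  by rewrite mul0n avoid_empty// big_geq// pr_setT oppr0 expR0 subrr normr0 mul0r.
have im : (i * m <= i.+1 * m)%N by rewrite leq_mul2r leqnSn orbT.
have {}IH := IH (leq_trans im imn).
rewrite [X in expR (- X)](big_cat_nat (n := (i * m)%N))//= opprD expRD.
have h1 := avoid_product im imn.
have h2 := block_estimate (i * m) m.
rewrite -mulSnr in h2.
set E := 2 * _ * _ + _ in IH h1 *; set F := _ + (_ * t) ^+ 2 in IH h2 *.
set a := pr (avoid 0 (i * m)) in IH h1 *.
set b := pr (avoid (i * m) _) in h1 h2 *.
set x := expR _ in IH *; set y := expR _ in h2 *.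
have b0 : 0 <= b by exact: pr_ge0.
have b1 : b <= 1 by apply: pr_le1; exact: measurable_avoid.
have x0 : 0 <= x by exact: expR_ge0.
have x1 : x <= 1 by rewrite /x expR_le1 oppr_le0 sum_pr_ge0.
have -> : pr (avoid 0 (i.+1 * m)) - x * y =
  (pr (avoid 0 (i.+1 * m)) - a * b) + ((a - x) * b + x * (b - y)) by ring.
rewrite (le_trans (ler_normD _ _))//.
have g1 : `|(a - x) * b| <= i%:R * (E + F).
  by rewrite normrM (ger0_norm b0) -[leRHS]mulr1 ler_pM.
have g2 : `|x * (b - y)| <= F.
  by rewrite normrM (ger0_norm x0) -[leRHS]mul1r ler_pM.
have := lerD h1 (le_trans (ler_normD _ _) (lerD g1 g2)).
by move=> h; apply: le_trans h _; rewrite -natr1 mulrDl mul1r; lra.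
Qed.

(** The [k] blocks of length [n %/ k] leave at most [k] indices uncovered. Omitting them costs
    [k%:R * t] in the probability and again in the exponential, which turns [l] into [l.+1]. The
    squared block terms sum to order [1 / k]. *)
Lemma avoid_estimate k : (0 < k)%N ->
  `|pr (avoid 0 n) - expR (- \sum_(0 <= j < n) pr (B j))| <=
  2 * k%:R * (l.+1)%:R * t + k%:R * alpha +
  n%:R * \sum_(1 <= j < n %/ k) c j + (n%:R * t) ^+ 2 / k%:R.
Proof.
move=> k0; set m := (n %/ k)%N.
have kmn : (k * m <= n)%N by rewrite mulnC leq_trunc_div.
have nkm : (n - k * m <= k)%N.
  by rewrite [X in (X - _)%N](divn_eq n k) mulnC addKn ltnW// ltn_mod.
have h1 := avoid_blocks kmn.
have h2 := avoid_shorten measurableT kmn; rewrite !setTI in h2.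
have h3 : `|expR (- \sum_(0 <= j < k * m) pr (B j)) -
            expR (- \sum_(0 <= j < n) pr (B j))| <= k%:R * t.
  apply: (le_trans (expRN_lip (sum_pr_ge0 _ _) (sum_pr_ge0 _ _))).
  rewrite [X in `|_ - X|](big_cat_nat (n := (k * m)%N))//= opprD addrA subrr sub0r.
  rewrite normrN ger0_norm ?sum_pr_ge0// (le_trans (sum_pr_le _ _))//.
  by rewrite ler_wpM2r// ler_nat.
have h4 : (n - k * m)%:R * t <= k%:R * t by rewrite ler_wpM2r// ler_nat.
have kR : 0 < k%:R :> R by rewrite ltr0n.
have kmnR : k%:R * m%:R <= n%:R :> R by rewrite -natrM ler_nat.
have h5 : k%:R * (m%:R * \sum_(1 <= j < m) c j) <= n%:R * \sum_(1 <= j < m) c j.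
  rewrite mulrA ler_wpM2r// big_nat_cond.
  by apply: sumr_ge0 => i /andP[/andP[i1 _] _]; exact: c_ge0.
have h6 : k%:R * (m%:R * t) ^+ 2 <= (n%:R * t) ^+ 2 / k%:R.
  rewrite ler_pdivlMr// [leLHS](_ : _ = (k%:R * m%:R * t) ^+ 2); last by ring.
  by rewrite lerXn2r ?nnegrE ?mulr_ge0// ler_wpM2r.
have -> : pr (avoid 0 n) - expR (- \sum_(0 <= j < n) pr (B j)) =
  (pr (avoid 0 n) - pr (avoid 0 (k * m))) +
  (pr (avoid 0 (k * m)) - expR (- \sum_(0 <= j < k * m) pr (B j))) +
  (expR (- \sum_(0 <= j < k * m) pr (B j)) -
   expR (- \sum_(0 <= j < n) pr (B j))) by ring.
apply: (le_trans (ler_normD _ _)); apply: (le_trans (lerD (ler_normD _ _) h3)).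
apply: (le_trans (lerD (lerD (le_trans h2 h4) h1) (lexx _))).
by rewrite -natr1; lra.
Qed.

End blocks.

(** * Events of generated sigma-algebras *)

Lemma g_sigma_bigcap (T : Type) (G : set (set T)) (F : nat -> set T) :
  (forall k, <<s G >> (F k)) -> <<s G >> (\bigcap_k F k).
Proof.
move=> mF; rewrite -[X in <<s G >> X]setCK setC_bigcap -setTD.
apply: sigma_algebraCD; apply: sigma_algebra_bigcup => k.
by rewrite -setTD; exact: sigma_algebraCD (mF k).
Qed.

Lemma g_sigma_setI (T : Type) (G : set (set T)) (A B : set T) :
  <<s G >> A -> <<s G >> B -> <<s G >> (A `&` B).
Proof.
move=> mA mB; pose F k := if k is 0%N then A else B.
rewrite (_ : A `&` B = \bigcap_k F k).
  by apply: g_sigma_bigcap => -[|k].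
apply/seteqP; split=> w; first by move=> [Aw Bw] [|k].
by move=> h; split; [exact: (h 0%N I) | exact: (h 1%N I)].
Qed.

Section generated_sigma_algebra.
Context (R : realType) (T : Type) (Y : nat -> T -> R).

Lemma sigma_gen_preimage i (B : set R) : measurable B -> sigma_gen Y (Y i @^-1` B).
Proof.
by move=> mB; apply: sub_sigma_algebra; exists i => //; exists B; rewrite ?setTI.
Qed.

Lemma sigma_genT : sigma_gen Y setT.
Proof. by rewrite -(setD0 setT); apply: sigma_algebraCD; exact: sigma_algebra0. Qed.

Lemma sigma_gen_forall n (Q : 'I_n -> set R) : (forall i, measurable (Q i)) ->
  sigma_gen Y [set w | forall i : 'I_n, Q i (Y i w)].
Proof.
(* Indices from [n] on impose no constraint, which turns the finite conjunction into a countable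
   intersection. *)
move=> mQ; pose F k := if insub k is Some i then Y k @^-1` Q i else setT.
rewrite [X in sigma_gen Y X](_ : _ = \bigcap_k F k).
  apply: g_sigma_bigcap => k; rewrite /F.
  by case: insubP => [i _ _|_]; [exact: sigma_gen_preimage | exact: sigma_genT].
apply/seteqP; split=> w Qw.
  by move=> k _; rewrite /F; case: insubP => // i kn ik; rewrite -ik; exact: Qw.
by move=> i; have := Qw i I; rewrite /F valK.
Qed.

Lemma sigma_gen_below n (A : {set 'I_n}) u :
  sigma_gen Y [set w | forall j : 'I_n, j \in A -> Y j w <= u].
Proof.
pose Q (i : 'I_n) := if i \in A then `]-oo, u]%classic else setT.
rewrite [X in sigma_gen Y X](_ : _ = [set w | forall i, Q i (Y i w)]).
  by apply: (@sigma_gen_forall n Q) => i; rewrite /Q; case: ifP.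
rewrite /Q; apply/seteqP; split=> w /= h i; first last.
  by move=> iA; have := h i; rewrite iA /= in_itv.
by case: ifP => // iA /=; rewrite in_itv/=; exact: h.
Qed.

End generated_sigma_algebra.

(** * Exceedance events of a stationary sequence *)

Section stationary.
Context d (T : measurableType d) (R : realType) (P : probability T R).
Implicit Types X Y : nat -> {RV P >-> R}.

Lemma sigma_gen_measurable X (A : set T) :
  sigma_gen (fun i => X i : T -> R) A -> measurable A.
Proof.
apply: smallest_sub; first exact: sigma_algebra_measurable.
by move=> _ [i _ [B mB <-]]; apply: measurable_funP.
Qed.

Lemma measurable_exceed X j u : measurable [set w | u < X j w].
Proof.
rewrite (_ : [set w | _] = X j @^-1` `]u, +oo[); last first.
  by apply/seteqP; split=> w /=; rewrite in_itv/= andbT.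
have mB : measurable `]u, +oo[%classic by [].
apply: (sigma_gen_measurable (X := X)).
exact: (sigma_gen_preimage (Y := fun i => X i : T -> R) j mB).
Qed.

Lemma measurable_below X n (A : {set 'I_n}) u : measurable (below X A u).
Proof. 
apply: (sigma_gen_measurable (X := X)).
exact: (sigma_gen_below (Y := fun i => X i : T -> R) A u).
Qed.

Lemma below_law X Y n (A : {set 'I_n}) u : same_law X Y ->
  P (below X A u) = P (below Y A u).
Proof. by move=> /(_ _ (sigma_gen_below (Y := fun i (f : nat -> R) => f i) A u)). Qed.

Definition tail X u := pr P [set w | u < X 0%N w].
Definition tail2 X j u := pr P [set w | u < X 0%N w /\ u < X j w].

Variables (X : nat -> {RV P >-> R}) (Xstat : strictly_stationary X).

Lemma pr_exceed j u : pr P [set w | u < X j w] = tail X u.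
Proof.
have cyl : cylinder_sigma [set f : nat -> R | u < f 0%N].
  rewrite (_ : [set f | _] = (fun f => f 0%N) @^-1` `]u, +oo[%classic).
    exact: (sigma_gen_preimage (Y := fun i (f : nat -> R) => f i)).
  by apply/seteqP; split=> f /=; rewrite in_itv/= andbT.
exact: congr1 (Xstat j cyl).
Qed.

Lemma pr_exceed2 i j u : (i < j)%N ->
  pr P ([set w | u < X i w] `&` [set w | u < X j w]) = tail2 X (j - i) u.
Proof.
move=> ij.
have cyl : cylinder_sigma [set f : nat -> R | u < f 0%N /\ u < f (j - i)%N].
  pose Y k (f : nat -> R) := f (if k is 0 then 0 else j - i)%N.
  rewrite (_ : [set f | _] = \bigcap_k (Y k @^-1` `]u, +oo[%classic)).
    apply: g_sigma_bigcap => k.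
    by apply: (sigma_gen_preimage (Y := fun i (f : nat -> R) => f i)).
  apply/seteqP; split=> f /= h; last first.
    by split; [have := h 0%N I|have := h 1%N I]; rewrite /= in_itv/= andbT.
  by case=> [|k] _ /=; rewrite in_itv/= andbT; case: h.
have := congr1 fine (Xstat i cyl).
by rewrite /preimage/= subnK// ltnW.
Qed.

End stationary.

(** * Poisson approximation, uniform over the index sets *)

Section uniform_poisson.
Context d (T : measurableType d) (R : realType) (P : probability T R).
Variables (X : nat -> {RV P >-> R}) (Xstat : strictly_stationary X).
Local Notation tail := (tail X).
Local Notation tail2 := (tail2 X).

Lemma tail_nonincreasing u v : u <= v -> tail v <= tail u.
Proof.
move=> uv; apply: le_pr; [exact: measurable_exceed..|].
by move=> w /=; exact: le_lt_trans.
Qed.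

Lemma tail_ge0 u : 0 <= tail u.
Proof. exact: pr_ge0. Qed.

Lemma belowU n (A B : {set 'I_n}) u :
  below X (A :|: B) u = below X A u `&` below X B u.
Proof.
apply/seteqP; split=> w /=.
  by move=> h; split=> j jA; apply: h; rewrite finset.in_setU jA ?orbT.
by move=> [h1 h2] j; rewrite finset.in_setU => /orP[]; [exact: h1 | exact: h2].
Qed.

Section finite_horizon.
Variables (n : nat) (A1 A2 : {set 'I_n}) (A12 : A1 :&: A2 = finset.set0).
Variables (u v : R).

(** Membership extended to all of [nat], since the avoidance lemmas use events indexed by [nat]; it
    fails from [n] on, where [B] is empty. *)
Let memN (A : {set 'I_n}) (j : nat) : bool := j \in map val (enum A).

Let memNE A (i : 'I_n) : memN A i = (i \in A).
Proof. by rewrite /memN mem_map ?mem_enum//; exact: val_inj. Qed.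

Let memN_lt A j : memN A j -> exists2 i : 'I_n, j = i & i \in A.
Proof. by move=> /mapP[i]; rewrite mem_enum => iA ->; exists i. Qed.

Let B j : set T := [set w | (memN A1 j /\ u < X j w) \/ (memN A2 j /\ v < X j w)].

Let memN_disj j : memN A1 j -> memN A2 j -> False.
Proof.
move=> iA1 /memN_lt[i ij iA2]; move: iA1; rewrite ij memNE => iA1.

have : i \in A1 :&: A2 by rewrite finset.in_setI iA1.
by rewrite A12 finset.in_set0.
Qed.

Let B1 j : memN A1 j -> B j = [set w | u < X j w].
Proof.
move=> j1; apply/seteqP; split=> w /=; last by left.
by case=> -[]// j2; have := memN_disj j1 j2.
Qed.

Let B2 j : memN A2 j -> B j = [set w | v < X j w].
Proof.
move=> j1; apply/seteqP; split=> w /=; last by right.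
by case=> -[]// j2; have := memN_disj j2 j1.
Qed.

Let B0 j : ~~ memN A1 j -> ~~ memN A2 j -> B j = set0.
Proof.
by move=> /negP j1 /negP j2; apply/seteqP; split=> w //= [[]|[]].
Qed.

Let mB j : measurable (B j).
Proof.
case: (boolP (memN A1 j)) => [/B1->|h1]; first exact: measurable_exceed.
case: (boolP (memN A2 j)) => [/B2->|h2]; first exact: measurable_exceed.
by rewrite B0.
Qed.

Let prB j : pr P (B j) = (memN A1 j)%:R * tail u + (memN A2 j)%:R * tail v.
Proof.
case: (boolP (memN A1 j)) => h1; case: (boolP (memN A2 j)) => h2.
- by have := memN_disj h1 h2.
- by rewrite B1// pr_exceed// mul1r mul0r addr0.
- by rewrite B2// pr_exceed// mul1r mul0r add0r.
- by rewrite B0// /pr measure0 !mul0r addr0.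
Qed.

Let B_sub j : B j `<=` [set w | Num.min u v < X j w].
Proof. by move=> w /= [[_ h]|[_ h]]; rewrite gt_min h ?orbT. Qed.

Let sum_prB : \sum_(0 <= j < n) pr P (B j) = #|A1|%:R * tail u + #|A2|%:R * tail v.
Proof.
have card (A : {set 'I_n}) : \sum_(i < n) (memN A i)%:R = #|A|%:R :> R.
  rewrite -sum1_card natr_sum [RHS]big_mkcond/=; apply: eq_bigr => i _.
  by rewrite memNE; case: (i \in A).
rewrite big_mkord; under eq_bigr do rewrite prB.
by rewrite big_split/= -!mulr_suml !card.
Qed.

Let window s e : {set 'I_n} := [set i : 'I_n | (s <= i < e)%N].

(** Translates avoidance on an interval of indices into the events that condition D compares. *)
Let avoid_below s e : avoid B s e =
  below X (A1 :&: window s e) u `&` below X (A2 :&: window s e) v.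
Proof.
apply/seteqP; split=> w.
  move=> h; split=> j; rewrite finset.in_setI inE => /andP[jA sje]; rewrite leNgt;
    apply/negP => uX; apply: (h _ sje); [left|right]; by rewrite memNE.
move=> [h1 h2] j sje [[/memN_lt[i ij iA] uX]|[/memN_lt[i ij iA] uX]].
  by have := h1 i; rewrite finset.in_setI iA inE -ij sje leNgt uX => /(_ isT).
by have := h2 i; rewrite finset.in_setI iA inE -ij sje leNgt uX => /(_ isT).
Qed.

Variables (l : nat) (alpha : R).
Hypothesis mixing : forall A1 A2 B1 B2 : {set 'I_n},
  A1 :&: A2 = finset.set0 -> B1 :&: B2 = finset.set0 ->
  (forall a b : 'I_n, a \in A1 :|: A2 -> b \in B1 :|: B2 ->
     (l <= `|(a : nat) - (b : nat)|)%N) ->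
  (`| P (below X (A1 :|: B1) u `&` below X (A2 :|: B2) v)
      - P (below X A1 u `&` below X A2 v)
        * P (below X B1 u `&` below X B2 v) | <= alpha%:E)%E.

Let mixing_pr s e f : (s + l <= e)%N ->
  `|pr P (avoid B 0 s `&` avoid B e f) - pr P (avoid B 0 s) * pr P (avoid B e f)|
  <= alpha.
Proof.
move=> sle.
have disj s' e' : (A1 :&: window s' e') :&: (A2 :&: window s' e') = finset.set0.
  by rewrite finset.setIACA A12 finset.set0I.
have := @mixing _ _ _ _ (disj 0%N s) (disj e f).
have -> : below X ((A1 :&: window 0 s) :|: (A1 :&: window e f)) u `&`
    below X ((A2 :&: window 0 s) :|: (A2 :&: window e f)) v =
    avoid B 0 s `&` avoid B e f.
  by rewrite !avoid_below !belowU setIACA.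
rewrite -!avoid_below => h.
have ma a b := measurable_avoid mB a b.
rewrite -lee_fin; apply: le_trans (h _); last first.
  move=> a b; rewrite !inE -!andb_orl => /andP[_ aw] /andP[_ bw].
  by move: aw bw => /andP[_ as_] /andP[eb _]; lia.
by rewrite !prE//; exact: measurableI.
Qed.

(** The sets do not enter the error, so the bound is uniform over [A1] and [A2]. Both levels are at
    least their minimum, whose tails control single and joint exceedances. *)
Lemma below_estimate k : (0 < k)%N ->
  `|pr P (below X A1 u `&` below X A2 v) -
    expR (- (#|A1|%:R * tail u + #|A2|%:R * tail v))| <=
  2 * k%:R * l.+1%:R * tail (Num.min u v) + k%:R * alpha +
  n%:R * \sum_(1 <= j < n %/ k) tail2 j (Num.min u v) +
  (n%:R * tail (Num.min u v)) ^+ 2 / k%:R.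
Proof.
move=> k0; rewrite -sum_prB.
have -> : below X A1 u `&` below X A2 v = avoid B 0 n.
  have wT : window 0 n = finset.setT by apply/setP => i; rewrite !inE ltn_ord.
  by rewrite avoid_below wT !finset.setIT.
apply: avoid_estimate => //.
- move=> j; rewrite -(pr_exceed Xstat j).
  by apply: le_pr => //; exact: measurable_exceed.
- move=> i j ij; rewrite -(pr_exceed2 Xstat _ ij).
  apply: le_pr; [exact: measurableI| |exact: setISS].
  by apply: measurableI; exact: measurable_exceed.
(* The mixing bound for two empty windows already forces [alpha >= 0]. *)
- exact: le_trans (normr_ge0 _) (@mixing_pr 0 l l (leqnn _)).
- by move=> s e f sle _; exact: mixing_pr.
Qed.

End finite_horizon.

End uniform_poisson.

(** * Passage to the limit under D and D' *)

Section uniform_limit.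
Context d (T : measurableType d) (R : realType) (P : probability T R).
Variables (X : nat -> {RV P >-> R}) (Xstat : strictly_stationary X).

Lemma condD'_near (w : nat -> R) (e : R) : condD' X w -> 0 < e ->
  \forall k \near \oo, \forall n \near \oo,
    n%:R * \sum_(1 <= j < n %/ k) tail2 X j (w n) < e.
Proof.
move=> D' e0; rewrite /condD' in D'.
have e0' : (0%:E < e%:E)%E by rewrite lte_fin.
have : \forall k \near \oo, (limn_esup (fun n : nat =>
    n%:R%:E * \sum_(1 <= j < n %/ k)
      P [set w0 | (w n < X 0%N w0)%R /\ (w n < X j w0)%R]) < e%:E)%E.
  exact: D' _ (open_ereal_lt' e0').
(* The upper limit is an infimum of suprema over neighbourhoods, so being below [e] provides one
   neighbourhood on which every term is. *)
apply: filterS => k; rewrite /limn_esup limf_esupE => /ereal_inf_lt[_ [V nV <-] Ve].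
apply: filterS nV => n Vn; rewrite -lte_fin; apply: le_lt_trans Ve.
apply: ereal_sup_ubound; exists n => //.
rewrite EFinM -sumEFin; congr (_ * _)%E; apply: eq_bigr => j _.
by rewrite prE//; apply: measurableI; exact: measurable_exceed.
Qed.

(** First [k] is fixed, large enough for D' and for [K ^+ 2 / k]; then [n] grows and makes the gap
    and mixing terms small. Each of the four terms gets [e / 4]. *)
Lemma below_asymptotics (u v w : nat -> R) (K e : R) :
  condD X u v -> condD' X w ->
  (\forall n \near \oo, w n = Num.min (u n) (v n)) ->
  (\forall n \near \oo, n%:R * tail X (w n) <= K) ->
  0 < e ->
  \forall n \near \oo, forall A1 A2 : {set 'I_n}, A1 :&: A2 = finset.set0 ->
   `|pr P (below X A1 (u n) `&` below X A2 (v n)) -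
     expR (- (#|A1|%:R * tail X (u n) + #|A2|%:R * tail X (v n)))| <= e.
Proof.
move=> [alpha [mixing [l [ln0 alpha0]]]] D' wE wK e0.
wlog K0 : K wK / 0 < K => [H|].
  apply: (H (Num.max K 1)); last by rewrite lt_max ltr01 orbT.
  by apply: filterS wK => n h; rewrite le_max h.
have e4 : 0 < e / 4 by rewrite divr_gt0.
near \oo => k.
have k0 : (0 < k)%N by near: k; exists 1%N.
have kR : 0 < k%:R :> R by rewrite ltr0n.
have kK : K ^+ 2 / k%:R <= e / 4.
  rewrite ler_pdivrMr// -ler_pdivrMl//.
  by near: k; exact: nbhs_infty_ger.
have Dk : \forall n \near \oo, n%:R * \sum_(1 <= j < n %/ k) tail2 X j (w n) < e / 4.
  by near: k; exact: condD'_near.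
(* Eventually [l n] and 1 are both at most [dl * n], whence [l n + 1 <= 2 * dl * n]; this [dl] makes
   the gap term at most [e / 4]. *)
have [dl dl0 dlE] : exists2 dl, 0 < dl & 2 * k%:R * (2 * dl) * K = e / 4.
  exists (e / (16 * k%:R * K)); first by rewrite divr_gt0// !mulr_gt0.
  by field; rewrite gt_eqF//= pnatr_eq0 -lt0n k0.
have ln_small : \forall n \near \oo, (l n)%:R / n%:R < dl.
  exact: (cvgr_lt _ ln0).
have n_large : \forall n \near \oo, dl^-1 <= n%:R :> R by exact: nbhs_infty_ger.
have alpha_small : \forall n \near \oo, alpha n (l n) < e / 4 / k%:R.
  by apply: (cvgr_lt _ alpha0); rewrite divr_gt0.
near=> n => A1 A2 A12.
apply: le_trans (below_estimate Xstat A12 (mixing n (l n)) k0) _.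
have <- : w n = Num.min (u n) (v n) by near: n.
have n0 : 0 < n%:R :> R.
  apply: (@lt_le_trans _ _ dl^-1); first by rewrite invr_gt0.
  by near: n.
have h1 : n%:R * \sum_(1 <= j < n %/ k) tail2 X j (w n) <= e / 4.
  by apply: ltW; near: n.
have h2 : k%:R * alpha n (l n) <= e / 4.
  by rewrite mulrC -ler_pdivlMr//; apply: ltW; near: n.
have t0 := tail_ge0 X (w n).
have tK : n%:R * tail X (w n) <= K by near: n.
have h3 : (n%:R * tail X (w n)) ^+ 2 / k%:R <= e / 4.
  apply: le_trans kK; rewrite ler_pM2r ?invr_gt0//.
  by rewrite lerXn2r ?nnegrE ?mulr_ge0// ltW.
have h4 : 2 * k%:R * (l n).+1%:R * tail X (w n) <= e / 4.
  have l1 : (l n).+1%:R <= 2 * dl * n%:R.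
    have a1 : (l n)%:R <= dl * n%:R.
      by rewrite -ler_pdivrMr//; apply: ltW; near: n.
    have a2 : 1 <= dl * n%:R by rewrite mulrC -ler_pdivrMr// div1r; near: n.
    by rewrite -natr1 -mulrA; lra.
  have kk : 0 <= 2 * k%:R * tail X (w n) by rewrite !mulr_ge0.
  have := ler_wpM2l kk l1.
  have : 2 * k%:R * (2 * dl) * (n%:R * tail X (w n)) <= 2 * k%:R * (2 * dl) * K.
    by rewrite ler_wpM2l// !mulr_ge0// ltW.
  rewrite dlE.
  have -> : 2 * k%:R * tail X (w n) * (2 * dl * n%:R) =
    2 * k%:R * (2 * dl) * (n%:R * tail X (w n)) by ring.
  have -> : 2 * k%:R * tail X (w n) * (l n).+1%:R =
    2 * k%:R * (l n).+1%:R * tail X (w n) by ring.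
  by move=> h h'; exact: le_trans h' h.
lra.
Unshelve. all: by end_near. Qed.

End uniform_limit.

(** * Continuity of the limit distribution function *)

(** A multiplier [p] with [p * (s - r) > 1] leaves room for an integer strictly between [p * r] and
    [p * s]. *)
Lemma nat_ratio_between (R : realType) (r s : R) : 0 <= r -> r < s ->
  exists p q : nat, [/\ (0 < p)%N, (0 < q)%N, p%:R * r < q%:R & q%:R < p%:R * s].
Proof.
move=> r0 rs; have sr0 : 0 <= (s - r)^-1 by rewrite invr_ge0 subr_ge0 ltW.
set p := (Num.truncn (s - r)^-1).+1.
have /andP[_ hp] := truncn_itv sr0; rewrite -/p in hp.
have pr0 : 0 <= p%:R * r by rewrite mulr_ge0.
exists p, (Num.truncn (p%:R * r)).+1; split=> //.
  by have /andP[] := truncn_itv pr0.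
have /andP[h _] := truncn_itv pr0.
rewrite -natr1; apply: le_lt_trans (lerD h (lexx 1)) _.
rewrite -ltrBrDl -mulrBr -ltr_pdivrMr ?subr_gt0//.
by rewrite div1r.
Qed.

(** * Values and continuity points of a distribution function *)

Section distribution_function.
Context (R : realType) (G : cumulativeBounded (0 : R) (1 : R)).

Lemma df_mono x y : x <= y -> G x <= G y.
Proof. exact: cumulative_is_nondecreasing. Qed.

Lemma df_lt x y : G x < G y -> x < y.
Proof. by move=> h; rewrite ltNge; apply: contraTN h => /df_mono; rewrite leNgt. Qed.

Lemma df_ge0 x : 0 <= G x.
Proof.
apply: (cvgr_to_le (cumulativeNy G)); near=> z.
by apply: df_mono; near: z; apply: nbhs_ninfty_le; rewrite num_real.
Unshelve. all: by end_near. Qed.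

Lemma df_le1 x : G x <= 1.
Proof.
apply: (cvgr_to_ge (cumulativey G)); near=> z.
by apply: df_mono; near: z; apply: nbhs_pinfty_ge; rewrite num_real.
Unshelve. all: by end_near. Qed.

Lemma df_ex_lt c : 0 < c -> exists z, G z < c.
Proof. by move=> c0; apply: (filter_ex (cvgr_lt _ (cumulativeNy G) _ c0)). Qed.

Lemma df_ex_gt c : c < 1 -> exists z, c < G z.
Proof. by move=> c1; apply: (filter_ex (cvgr_gt _ (cumulativey G) _ c1)). Qed.

Lemma df_right x c : G x < c -> exists2 z, x < z & G z < c.
Proof.
move=> xc; have h : \forall t \near x^'+, G t < c.
  exact: (cvgr_lt _ (cumulative_is_right_continuous G x)).
have [z [xz Gz]] := filter_ex (filterI (nbhs_right_gt x) h).
by exists z.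
Qed.

Lemma df_continuous_from_left x :
  (forall e, 0 < e -> exists2 z, z < x & G x - e < G z) ->
  {for x, continuous (G : R -> R)}.
Proof.
move=> H; apply/left_right_continuousP; split; last exact: cumulative_is_right_continuous.
apply/cvgrPdist_lt => e e0; have [z zx Gz] := H _ e0.
near=> y.
have zy : z <= y by near: y; exact: nbhs_left_ge.
have yx : y <= x by apply: ltW; near: y; exact: nbhs_left_lt.
rewrite ger0_norm ?subr_ge0 ?df_mono//.
by have := df_mono zy; lra.
Unshelve. all: by end_near. Qed.

(** A monotone function has countably many discontinuities, while an open interval has positive
    Lebesgue measure. *)
Lemma df_continuity_dense x y : x < y ->
  exists z, [/\ x < z, z < y & {for z, continuous (G : R -> R)}].
Proof.
move=> xy; apply: contrapT => H.
have ndG : {in `[x, y] &, nondecreasing_fun (G : R -> R)}.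
  by move=> s t _ _; exact: df_mono.
have Gl z : cvg (G t @[t --> z^'-]).
  apply: nondecreasing_at_left_is_cvgr; near=> s.
    by move=> p q _ _; exact: df_mono.
  by exists 1 => _ [p _ <-]; exact: df_le1.
have /countable_lebesgue_measure0 : countable `]x, y[%classic.
  apply: sub_countable (discontinuity_countable ndG); apply: subset_card_le.
  move=> z /= zxy; split=> //.
  have Gr := cumulative_is_right_continuous G z.
  split=> //; first by apply/cvg_ex; exists (G z).
  apply/eqP => lr; apply: H; exists z.
  move: zxy; rewrite in_itv/= => /andP[? ?]; split=> //.
  apply/left_right_continuousP; split=> //.
  by have -> : G z = lim (G t @[t --> z^'-]) by rewrite lr; apply/esym/cvg_lim.
rewrite /= lebesgue_measure_itv/= lte_fin xy -EFinD => -[].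
by move/eqP; rewrite subr_eq0 gt_eqF.
Unshelve. all: by end_near. Qed.

(** If [G] took only the values 0 and 1, it would be the step at the infimum of the points with
    [G > 0], where right-continuity gives the value 1. *)
Lemma nondegenerate_ex : nondegenerate_df G -> exists z, 0 < G z < 1.
Proof.
move=> ndG; apply: contrapT => H; apply: ndG.
have G01 z : G z = 0 \/ G z = 1.
  have := df_ge0 z; have := df_le1 z; rewrite le_eqVlt => /orP[/eqP->|z1]; first by right.
  rewrite le_eqVlt => /orP[/eqP<-|z0]; first by left.
  by exfalso; apply: H; exists z; rewrite z0.
have [z0 Gz0] := df_ex_lt (@ltr01 R).
have [z1 Gz1] := df_ex_gt (@ltr01 R).
pose S := [set z | 0 < G z].
have S0 : S !=set0 by exists z1.
have lbS : has_lbound S.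
  exists z0 => z Sz; apply/ltW/df_lt; have [->//|Ez] := G01 z0.
  by move: Gz0; rewrite Ez ltxx.
have GS : 0 < G (inf S).
  rewrite lt_neqAle df_ge0 andbT; apply/eqP => E.
  have [z zS Gz] : exists2 z, inf S < z & G z < 1 by apply: df_right; rewrite -E.
  have [t St tz] := inf_lt S0 zS.
  have := df_mono (ltW tz); case: (G01 z) => Ez; last by move: Gz; rewrite Ez ltxx.
  by rewrite Ez leNgt St.
exists (inf S) => z; case: leP => [Sz|zS].
  by case: (G01 z) => // Ez; have := lt_le_trans GS (df_mono Sz); rewrite Ez ltxx.
case: (G01 z) => // Ez; have : S z by rewrite /S/= Ez.
by move=> /(ge_inf lbS); rewrite leNgt zS.
Qed.

End distribution_function.

(** * Comparison of norming constants and absence of jumps *)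

Section max_stable_limit.
Context (R : realType) (G : cumulativeBounded (0 : R) (1 : R)).
Variables (F : R -> R) (a b : nat -> R).
Hypothesis F_mono : {homo F : x y / x <= y}.
Hypothesis F_ge0 : forall x, 0 <= F x.
Hypothesis a_gt0 : forall n, (0 < n)%N -> 0 < a n.
Local Notation u := (fun n x => (a n)^-1 * x + b n).
Hypothesis FG : forall x, {for x, continuous (G : R -> R)} ->
  F (u n x) ^+ n @[n --> \oo] --> G x.

Lemma norming_le n x y : (0 < n)%N -> x <= y -> u n x <= u n y.
Proof. by move=> n0 xy; rewrite lerD2r ler_wpM2l// invr_ge0 ltW// a_gt0. Qed.

Let expR_root (L : R) n : (0 < n)%N -> expR (- L) = expR (- (L / n%:R)) ^+ n.
Proof.
move=> n0; rewrite -expRM_natr; congr expR.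
by rewrite mulNr mulfVK// pnatr_eq0 -lt0n.
Qed.

(** Convergence holds at continuity points only, so one is taken just right of [x]; taking n-th
    roots then turns a bound on [F ^+ n] into one on [F]. *)
Let near_lt x L : G x < expR (- L) ->
  \forall n \near \oo, F (u n x) < expR (- (L / n%:R)).
Proof.
move=> /df_right[x' xx' Gx'].
have [z [xz zx' Gz]] := df_continuity_dense G xx'.
have h : G z < expR (- L) by apply: le_lt_trans Gx'; exact/df_mono/ltW.
have n0 : \forall n \near \oo, (0 < n)%N by exists 1%N.
near=> n; have n1 : (0 < n)%N by near: n.
apply: (@le_lt_trans _ _ (F (u n z))); first by apply/F_mono/norming_le/ltW.
rewrite -(ltr_pXn2r n1) ?nnegrE ?expR_ge0// -expR_root//.
by near: n; exact: (cvgr_lt _ (FG Gz)).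
Unshelve. all: by end_near. Qed.

Let near_gt x y L : x < y -> expR (- L) < G x ->
  \forall n \near \oo, expR (- (L / n%:R)) < F (u n y).
Proof.
move=> xy Gx.
have [z [xz zy Gz]] := df_continuity_dense G xy.
have h : expR (- L) < G z by apply: lt_le_trans Gx _; exact/df_mono/ltW.
have n0 : \forall n \near \oo, (0 < n)%N by exists 1%N.
near=> n; have n1 : (0 < n)%N by near: n.
apply: (@lt_le_trans _ _ (F (u n z))); last by apply/F_mono/norming_le/ltW.
rewrite -(ltr_pXn2r n1) ?nnegrE ?expR_ge0// -expR_root//.
by near: n; exact: (cvgr_gt _ (FG Gz)).
Unshelve. all: by end_near. Qed.

Let near_mul p (Q : nat -> Prop) : (0 < p)%N ->
  (\forall n \near \oo, Q n) -> \forall n \near \oo, Q (p * n)%N.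
Proof.
move=> p0 [N _ NQ]; exists N => // n /= Nn; apply: NQ => /=.
exact: leq_trans Nn (leq_pmull _ p0).
Qed.

(* Rescaling time by [p / q] turns the level [exp (- L)] of [G] into
   [exp (- L * q / p)], which compares the norming constants at times [p * n]
   and [q * n] although no relation between them is assumed. *)
Lemma norming_compare p q x y y' L M : (0 < p)%N -> (0 < q)%N ->
  G x < expR (- L) -> expR (- M) < G y -> y < y' ->
  p%:R * M <= q%:R * L ->
  \forall n \near \oo, u (p * n)%N x < u (q * n)%N y'.
Proof.
move=> p0 q0 Gx Gy yy' pq.
have n0 : \forall n \near \oo, (0 < n)%N by exists 1%N.
have h1 := near_mul p0 (near_lt Gx).
have h2 := near_mul q0 (near_gt yy' Gy).
near=> n.
have : F (u (p * n)%N x) < F (u (q * n)%N y').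
  apply: (@lt_le_trans _ _ (expR (- (M / (q * n)%:R)))); last first.
    by apply: ltW; near: n; exact: h2.
  apply: (@lt_le_trans _ _ (expR (- (L / (p * n)%:R)))).
    by near: n; exact: h1.
  have n1 : 0 < n%:R :> R by rewrite ltr0n; near: n.
  have p1 : 0 < p%:R :> R by rewrite ltr0n.
  have q1 : 0 < q%:R :> R by rewrite ltr0n.
  rewrite ler_expR lerN2 !natrM ler_pdivrMr ?mulr_gt0//.
  rewrite [leRHS](_ : _ = L * p%:R^-1 * q%:R); last by field; rewrite !gt_eqF.
  by rewrite mulrAC ler_pdivlMr// mulrC [leRHS]mulrC.
by move=> h; rewrite ltNge; apply: contraTN h => /F_mono; rewrite leNgt.
Unshelve. all: by end_near. Qed.

Hypothesis Gnondeg : nondegenerate_df G.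

Let level (c : R) : 0 < c -> exists L : R, expR (- L) = c.
Proof. by move=> /expR_total[L <-]; exists (- L); rewrite opprK. Qed.

(** Suppose [G] jumps at [x]. For two times of suitable ratio, an arbitrarily small window around
    [x] in one scale would cover a fixed interval in the other, since the rescaled levels are all
    crossed inside the jump. Further comparisons bound the ratio of the two scales, a
    contradiction. *)
Lemma max_stable_continuous x : {for x, continuous (G : R -> R)}.
Proof.
apply: df_continuous_from_left => e e0; apply: contrapT => H.
have jump z : z < x -> G z <= G x - e.
  by move=> zx; rewrite leNgt; apply/negP => h; apply: H; exists z.
have Gxe : 0 <= G x - e.
  by apply: le_trans (df_ge0 G (x - 1)) (jump _ _); rewrite gtrBl.
have Gx1 := df_le1 G x.
have [s /andP[s0 s1]] := nondegenerate_ex Gnondeg.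
have [Ls LsE] := level s0.
have Ls0 : 0 < Ls by rewrite -oppr_lt0 -expR_lt1 LsE.
have [L1 L1E] : exists L, expR (- L) = G x - e / 2 by apply: level; lra.
have [L2 L2E] : exists L, expR (- L) = G x - e / 4 by apply: level; lra.
have L12 : L2 < L1 by rewrite -ltrN2 -ltr_expR L1E L2E; lra.
have L20 : 0 < L2 by rewrite -oppr_lt0 -expR_lt1 L2E; lra.
have L10 : 0 < L1 by exact: lt_trans L12.
have Ls12 : Ls / L1 < Ls / L2 by rewrite ltr_pM2l// ltf_pV2.
(* The ratio satisfies [q * L2 / p < Ls < q * L1 / p]: rescaling carries two levels inside the jump
   to levels on either side of [G s]. *)
have [p [q [p0 q0 pq qp]]] := nat_ratio_between (ltW (divr_gt0 Ls0 L10)) Ls12.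
have p1 : 0 < p%:R :> R by rewrite ltr0n.
have q1 : 0 < q%:R :> R by rewrite ltr0n.
pose L3 := q%:R * L1 / p%:R; pose L4 := q%:R * L2 / p%:R.
have L3s : expR (- L3) < G s.
  rewrite -LsE ltr_expR ltrN2 /L3 ltr_pdivlMr//.
  by move: pq; rewrite mulrA ltr_pdivrMr// mulrC.
have L4s : G s < expR (- L4).
  rewrite -LsE ltr_expR ltrN2 /L4 ltr_pdivrMr//.
  by move: qp; rewrite mulrA ltr_pdivlMr// [Ls * _]mulrC.
have pL3 : p%:R * L3 <= q%:R * L1 by rewrite /L3 mulrC mulfVK ?gt_eqF.
have pL4 : q%:R * L2 <= p%:R * L4 by rewrite /L4 [leRHS]mulrC mulfVK ?gt_eqF.
have [x2 sx2 Gx2] := df_right L4s.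
pose x3 := (s + x2) / 2; have sx3 : s < x3 by rewrite /x3; lra.
have x32 : x3 < x2 by rewrite /x3; lra.
have [y2 sy2 Gy2] := df_right s1.
pose y1 := (s + y2) / 2; have sy1 : s < y1 by rewrite /y1; lra.
have y12 : y1 < y2 by rewrite /y1; lra.
have [L5 [L5s L5_gt0]] : exists L, G y2 < expR (- L) /\ 0 < L.
  have [L LE] : exists L, expR (- L) = (1 + G y2) / 2.
    by apply: level; have := df_ge0 G y2; lra.
  by exists L; rewrite -oppr_lt0 -expR_lt1 LE; split; lra.
have Ls' : expR (- (2 * Ls)) < G s by rewrite -LsE ltr_expR ltrN2; lra.
(* [Z1] and [Z2] lie so far in the tails of [G] that, in the scale of time [q * n], [Z1] and
   [Z2 + 1] enclose [y1] and [y2] taken in the scale of time [p * n]. *)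
have [Z1 GZ1] := df_ex_lt G (expR_gt0 (- (q%:R * (2 * Ls) / p%:R))).
have [Z2 GZ2] : exists z, expR (- (q%:R * L5 / p%:R)) < G z.
  by apply: df_ex_gt; rewrite expR_lt1 oppr_lt0 divr_gt0// mulr_gt0.
have Z2' : Z2 < Z2 + 1 by rewrite ltrDl.
have c1 : \forall n \near \oo, u (q * n)%N Z1 < u (p * n)%N y1.
  apply: (norming_compare q0 p0 GZ1 Ls' sy1).
  by rewrite [leRHS]mulrC mulfVK ?gt_eqF.
have c2 : \forall n \near \oo, u (p * n)%N y2 < u (q * n)%N (Z2 + 1).
  apply: (norming_compare p0 q0 L5s GZ2 Z2').
  by rewrite mulrC mulfVK ?gt_eqF.
pose D := `|Z2 + 1 - Z1| + 1.
have D0 : 0 < D by rewrite ltr_wpDl.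
(* With [A] and [A'] the scales at times [p * n] and [q * n], the bound [A * (y2 - y1) <= A' * D]
   makes the window width [A * (2 * dl)] at most half of the length [A' * (x2 - x3)] that it has to
   cover. *)
pose dl := (x2 - x3) * (y2 - y1) / (4 * D).
have dl0 : 0 < dl by rewrite divr_gt0 ?mulr_gt0 ?subr_gt0.
have Gxm : G (x - dl) < expR (- L1).
  by rewrite L1E; apply: le_lt_trans (jump _ _) _; [rewrite gtrBl | lra].
have Gxp : expR (- L2) < G x by rewrite L2E; lra.
have xdl : x < x + dl by rewrite ltrDl.
have c3 := norming_compare p0 q0 Gxm L3s sx3 pL3.
have c4 := norming_compare q0 p0 Gx2 Gxp xdl pL4.
have n0 : \forall n \near \oo, (0 < n)%N by exists 1%N.
have [n [[[[h1 h2] h3] h4] n1]] :=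
  filter_ex (filterI (filterI (filterI (filterI c1 c2) c3) c4) n0).
have ap : 0 < (a (p * n))^-1 by rewrite invr_gt0 a_gt0// muln_gt0 p0.
have aq : 0 < (a (q * n))^-1 by rewrite invr_gt0 a_gt0// muln_gt0 q0.
set A := (a (p * n))^-1 in h1 h2 h3 h4 ap; set A' := (a (q * n))^-1 in h1 h2 h3 h4 aq.
have k1 : A * (y2 - y1) <= A' * D.
  have : A' * (Z2 + 1 - Z1) <= A' * D.
    by rewrite ler_wpM2l// ?(ltW aq)// /D; have := ler_norm (Z2 + 1 - Z1); lra.
  by lra.
have k2 : A' * (x2 - x3) <= A * (2 * dl) by lra.
have k3 : A' * (x2 - x3) * (y2 - y1) <= A' * D * (2 * dl).
  apply: (@le_trans _ _ (A * (2 * dl) * (y2 - y1))).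
    by rewrite ler_wpM2r// subr_ge0 ltW.
  by rewrite mulrAC ler_wpM2r// mulr_ge0// ltW.
have k4 : A' * D * (2 * dl) = A' * (x2 - x3) * (y2 - y1) / 2.
  by rewrite /dl; field; rewrite gt_eqF.
have k5 : 0 < A' * (x2 - x3) * (y2 - y1) by rewrite !mulr_gt0// subr_gt0.
lra.
Qed.

End max_stable_limit.

(** * Expected number of exceedances of a level *)

Section tail_limit.
Context d (T : measurableType d) (R : realType) (P : probability T R).
Variable X : nat -> {RV P >-> R}.

Lemma cdf_tail r : cdf (X 0%N) r = (1 - tail X r)%:E.
Proof.
rewrite /cdf /distribution /pushforward/=.
rewrite (_ : _ @^-1` _ = ~` [set w | r < X 0%N w]); last first.
  by apply/seteqP; split=> w /=; rewrite in_itv/= leNgt => /negP.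
by rewrite probability_setC ?prE ?EFinB//; exact: measurable_exceed.
Qed.

Lemma tail_le1 r : tail X r <= 1.
Proof. by apply: pr_le1; exact: measurable_exceed. Qed.

(** Applying [1 + z <= expR z] at [ln F] and [- ln F] encloses [1 - F] between [- F * ln F] and
    [- ln F]. Continuity of [ln] gives [- n * ln F --> - ln g], hence [F --> 1], so both bounds
    times [n] have the same limit. *)
Lemma tail_cvg (u : nat -> R) (g : R) : 0 < g ->
  (1 - tail X (u n)) ^+ n @[n --> \oo] --> g ->
  n%:R * tail X (u n) @[n --> \oo] --> - ln g.
Proof.
move=> g0 ug; pose F n : R := 1 - tail X (u n); pose s n : R := n%:R * - ln (F n).
have F_gt0 : \forall n \near \oo, 0 < F n.
  have h : \forall n \near \oo, 0 < F n ^+ n by exact: (cvgr_gt _ ug).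
  near=> n; rewrite lt_neqAle subr_ge0 tail_le1 andbT eq_sym.
  apply/eqP => E; have : 0 < F n ^+ n by near: n.
  rewrite E expr0n; suff -> : (n == 0)%N = false by rewrite ltxx.
  by apply/negbTE; rewrite -lt0n; near: n; exists 1%N.
have sg : s n @[n --> \oo] --> - ln g.
  have : - ln (F n ^+ n) @[n --> \oo] --> - ln g.
    by apply: cvgN; apply: (cvg_comp _ _ ug); exact: continuous_ln.
  apply: cvg_trans; apply: near_eq_cvg; near=> n.
  by rewrite lnXn ?/s ?mulrN ?mulr_natl//; near: n.
have tail_ln n : 0 < F n -> F n * - ln (F n) <= tail X (u n) <= - ln (F n).
  have FE : F n = 1 - tail X (u n) by [].
  move=> Fn; have := expR_ge1Dx (ln (F n)); have := expR_ge1Dx (- ln (F n)).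
  rewrite expRN !lnK// => h1 h2; apply/andP; split; last by lra.
  move: h1; rewrite -(ler_pM2l Fn) mulfV ?gt_eqF//.
  by lra.
have sn0 : s n / n%:R @[n --> \oo] --> 0.
  rewrite -(mulr0 (- ln g)); apply: cvgM => //.
  by apply/gtr0_cvgV0; [exists 1%N => // n /=; rewrite ltr0n | exact: cvgr_idn].
have F1 : F n @[n --> \oo] --> (1 : R).
  have h : (1 - s n / n%:R : R) @[n --> \oo] --> (1 : R).
    by rewrite -[X in _ --> X]subr0; apply: cvgB => //; exact: cvg_cst.
  apply: squeeze_cvgr h (cvg_cst _); near=> n.
  have n0 : (0 < n)%N by near: n; exists 1%N.
  have /tail_ln /andP[_ h2] : 0 < F n by near: n.
  rewrite -[F n]/(1 - tail X (u n)) lerD2l lerN2 gerBl tail_ge0 andbT.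
  by rewrite /s mulrAC mulfV ?mul1r// pnatr_eq0 -lt0n.
have Fs : F n * s n @[n --> \oo] --> - ln g.
  by rewrite -[X in _ --> X]mul1r; exact: cvgM.
apply: squeeze_cvgr Fs sg; near=> n.
have /tail_ln /andP[h1 h2] : 0 < F n by near: n.
by rewrite /s mulrCA !ler_wpM2l.
Unshelve. all: by end_near. Qed.

End tail_limit.

(** * Conditioning on the switching variables *)

Section finite_sum_expectation.
Context d (T : measurableType d) (R : realType) (P : probability T R).

Lemma integral_sum_indic (I : finType) (c : I -> R) (V : I -> set T) :
  (forall i, 0 <= c i) -> (forall i, measurable (V i)) ->
  (\int[P]_w (\sum_i c i * \1_(V i) w)%:E = (\sum_i c i * pr P (V i))%:E)%E.
Proof.
move=> c0 mV; under eq_integral do rewrite -sumEFin.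
rewrite ge0_integral_sum//; last 2 first.
- by move=> i; apply/measurable_EFinP; apply: measurable_funM.
- by move=> i w _; rewrite lee_fin mulr_ge0.
rewrite -sumEFin; apply: eq_bigr => i _.
rewrite (integralZl_indic measurableT (fun=> V i))//; last first.
  by move=> ci; have := c0 i; rewrite leNgt ci.
by rewrite integral_indic// setIT EFinM -prE.
Qed.

End finite_sum_expectation.

Section conditioning.
Context d (T : measurableType d) (R : realType) (P : probability T R).
Variables (X X' eps : nat -> {RV P >-> R}).
Hypothesis eps01 : forall (n : nat) (w : T), eps n w = 0 \/ eps n w = 1.
Hypothesis eps_indep : indep_seq eps X.
Hypothesis X'_law : same_law X' X.
Hypothesis X'_indep : indep_seq_pair X' X eps.

Definition ones n (w : T) : {set 'I_n} := [set i : 'I_n | eps i w == 1].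
Definition pattern n (A : {set 'I_n}) : set T := [set w | ones n w = A].
Definition joint n (u v : R) : set T :=
  [set w | forall i : 'I_n, switched eps X X' i w <= u /\ X i w <= v].

Lemma running_maxP (Y : nat -> T -> R) n w c : (0 < n)%N ->
  running_max Y n w <= c <-> forall i : 'I_n, Y i w <= c.
Proof.
move=> n0; split=> [/bigmax_leP[_ h] i|h]; first exact: h.
by apply/bigmax_leP; split=> [|i _//]; exact: (h (Ordinal n0)).
Qed.

Lemma joint_running_max n u v : (0 < n)%N ->
  [set w | running_max (switched eps X X') n w <= u /\
           running_max (fun i => X i) n w <= v] = joint n u v.
Proof.
move=> n0; apply/seteqP; split=> w /=.
  by move=> [/(running_maxP _ _ _ n0) h1 /(running_maxP _ _ _ n0) h2] i; split.
by move=> h; split; apply/(running_maxP _ _ _ n0) => i; case: (h i).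
Qed.

Lemma sigma_gen_pattern n (A : {set 'I_n}) :
  sigma_gen (fun i => eps i : T -> R) (pattern A).
Proof.
pose Q (i : 'I_n) : set R := if i \in A then [set 1] else ~` [set 1].
rewrite (_ : pattern A = [set w | forall i, Q i (eps i w)]).
  apply: (@sigma_gen_forall _ _ _ n Q) => i; rewrite /Q.
  by case: ifP => _ //; exact: measurableC.
apply/seteqP; split=> w.
  by move=> pA i; rewrite /Q -pA inE; case: eqVneq => //= /eqP.
move=> h; apply/setP => i; rewrite inE; move: (h i); rewrite /Q.
by case: (i \in A) => /= [->|/eqP/negbTE->]; rewrite ?eqxx.
Qed.

Lemma measurable_pattern n (A : {set 'I_n}) : measurable (pattern A).
Proof. exact: (sigma_gen_measurable (X := eps)) (sigma_gen_pattern A). Qed.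

Lemma measurable_switched i : measurable_fun setT (switched eps X X' i).
Proof.
apply: measurable_funD; first by apply: measurable_funM; exact: measurable_funP.
by apply: measurable_funM; [apply: measurable_funB|].
Qed.

Lemma measurable_joint n u v : measurable (joint n u v).
Proof.
rewrite (_ : joint n u v = \bigcap_(i : 'I_n)
    (switched eps X X' i @^-1` `]-oo, u] `&` X i @^-1` `]-oo, v])).
  apply: fin_bigcap_measurable => // i _; apply: measurableI.
    by rewrite -[X in measurable X]setTI; exact: measurable_switched.
  exact: measurable_funPTI.
apply/seteqP; split=> w h i; last by have := h i I; rewrite /= !in_itv/= => -[].
by move=> _; have := h i; rewrite /= !in_itv/=.
Qed.

(** On [pattern A] the switched variable is [X] on [A] and [X'] off it. The event splits into
    constraints on [X'], on [eps] and on [X], which the independence hypotheses separate. *)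
Lemma joint_pattern n (A : {set 'I_n}) u v :
  joint n u v `&` pattern A = below X' (~: A) u `&`
    (pattern A `&` (below X A (Num.min u v) `&` below X (~: A) v)).
Proof.
apply/seteqP; split=> w; rewrite /joint /switched /=.
  move=> [h pA]; split; [|split=> //; split].
  - move=> i; rewrite -pA !inE => ei; case: (eps01 i w) => e; last first.
      by rewrite e eqxx in ei.
    by case: (h i) => + _; rewrite e mul0r add0r subr0 mul1r.
  - move=> i; rewrite -pA inE => /eqP ei; case: (h i).
    by rewrite ei mul1r subrr mul0r addr0 le_min => -> ->.
  - by move=> i _; case: (h i).
move=> [h1 [pA [h2 h3]]]; split=> // i.
case: (eps01 i w) => e.
  have iA : i \in ~: A by rewrite -pA !inE e eq_sym oner_eq0.
  by rewrite e mul0r add0r subr0 mul1r; split; [exact: h1 | exact: h3].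
have iA : i \in A by rewrite -pA !inE e.
by rewrite e mul1r subrr mul0r addr0; have := h2 i iA; rewrite le_min => /andP.
Qed.

Lemma pr_joint_pattern n (A : {set 'I_n}) u v :
  pr P (joint n u v `&` pattern A) = pr P (below X (~: A) u) *
    (pr P (pattern A) * pr P (below X A (Num.min u v) `&` below X (~: A) v)).
Proof.
have sX (B : {set 'I_n}) c := sigma_gen_below (Y := fun i => X i : T -> R) B c.
have mX (B : {set 'I_n}) c := measurable_below X B c.
have mA := measurable_pattern A.
have sXX : sigma_gen (fun i => X i : T -> R)
    (below X A (Num.min u v) `&` below X (~: A) v).
  exact: (g_sigma_setI (sX A _) (sX (~: A) v)).
apply: EFin_inj; rewrite !EFinM -!prE//; last 2 first.
- exact: measurableI.
- by apply: measurableI => //; exact: measurable_joint.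
rewrite joint_pattern X'_indep; last 2 first.
- exact: (sigma_gen_below (Y := fun i => X' i : T -> R)).
- apply: g_sigma_setI; apply: sub_sigma_algebra; last by left.
  by right; exact: sigma_gen_pattern.
by rewrite eps_indep//; [rewrite (below_law _ _ X'_law) | exact: sigma_gen_pattern].
Qed.

Let sum_pattern n (g : {set 'I_n} -> R) w :
  \sum_A g A * \1_(pattern A) w = g (ones n w).
Proof.
rewrite (bigD1 (ones n w))//= big1 ?addr0 => [|A Aw].
  by rewrite indicE mem_set// mulr1.
rewrite indicE memNset ?mulr0// => E; by rewrite E eqxx in Aw.
Qed.

Lemma integral_pattern n (g : {set 'I_n} -> R) : (forall A, 0 <= g A) ->
  (\int[P]_w (g (ones n w))%:E = (\sum_A g A * pr P (pattern A))%:E)%E.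
Proof.
move=> g0; rewrite -integral_sum_indic//; last exact: measurable_pattern.
by apply: eq_integral => w _; rewrite sum_pattern.
Qed.

Lemma pr_joint_sum n u v :
  pr P (joint n u v) = \sum_(A : {set 'I_n}) pr P (joint n u v `&` pattern A).
Proof.
have mJ := measurable_joint n u v.
apply: EFin_inj; rewrite -prE// -[joint n u v in LHS]setIT -integral_indic//.
under [in RHS]eq_bigr do rewrite -[pr _ _]mul1r.
rewrite -integral_sum_indic//; last first.
  by move=> A; apply: measurableI => //; exact: measurable_pattern.
apply: eq_integral => w _; congr EFin.
under eq_bigr do rewrite mul1r indicI/=.
by rewrite sum_pattern.
Qed.

Lemma sum_pr_pattern n : \sum_(A : {set 'I_n}) pr P (pattern A) = 1.
Proof.
apply: EFin_inj; under eq_bigr do rewrite -[pr _ _]mul1r.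
rewrite -(integral_pattern (g := fun=> 1))// integral_cst//=.
by rewrite mul1e; exact: probability_setT.
Qed.

(** The pattern probabilities sum to 1, so an error uniform in [A] survives averaging unchanged,
    whatever the joint law of [eps]. Each of the two factors, bounded by 1, costs [dl]. *)
Lemma joint_estimate n u v (x y : {set 'I_n} -> R) (dl : R) :
  (forall A, 0 <= x A) -> (forall A, 0 <= y A <= 1) ->
  (forall A, `|pr P (below X A (Num.min u v) `&` below X (~: A) v) - x A| <= dl) ->
  (forall A, `|pr P (below X (~: A) u) - y A| <= dl) ->
  (`|(pr P (joint n u v))%:E - \int[P]_w (x (ones n w) * y (ones n w))%:E|
    <= (2 * dl)%:E)%E.
Proof.
move=> x0 y01 hx hy.
rewrite (integral_pattern (g := fun A => x A * y A)); last first.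
  by move=> A; rewrite mulr_ge0//; case/andP: (y01 A).
rewrite -EFinB lee_fin pr_joint_sum -sumrB (le_trans (ler_norm_sum _ _ _))//.
rewrite -[leRHS]mulr1 -[X in _ <= _ * X](sum_pr_pattern n) mulr_sumr.
apply: ler_sum => A _.
rewrite pr_joint_pattern.
have := hx A; have := hy A; set p := pr P (below _ _ _); set q := pr P (_ `&` _).
set r := pr P _ => h1 h2.
have q0 : 0 <= q by exact: pr_ge0.
have q1 : q <= 1 by apply: pr_le1; apply: measurableI; exact: measurable_below.
have /andP[y0 y1] := y01 A.
have -> : p * (r * q) - x A * y A * r = ((p - y A) * q + y A * (q - x A)) * r by ring.
rewrite normrM (ger0_norm (pr_ge0 P _)) ler_wpM2r ?pr_ge0//.
have g1 : `|(p - y A) * q| <= dl by rewrite normrM (ger0_norm q0) -[dl]mulr1 ler_pM.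
have g2 : `|y A * (q - x A)| <= dl by rewrite normrM (ger0_norm y0) -[dl]mul1r ler_pM.
have := ler_normD ((p - y A) * q) (y A * (q - x A)); lra.
Qed.

Lemma partial_sum_ones n w : partial_sum (fun i => eps i) n w = #|ones n w|%:R.
Proof.
rewrite -sum1_card natr_sum /partial_sum [RHS]big_mkcond/=; apply: eq_bigr => i _.
by rewrite inE; case: (eps01 i w) => ->; rewrite ?eqxx// eq_sym oner_eq0.
Qed.

End conditioning.

(** * Distance between expectations of [0,1]-valued functions *)

Section expectation_distance.
Context d (T : measurableType d) (R : realType) (P : probability T R).
Implicit Types f g : T -> R.

Lemma integral01 f : measurable_fun setT f -> (forall w, 0 <= f w <= 1) ->
  (\int[P]_w (f w)%:E = (fine (\int[P]_w (f w)%:E))%:E)%E /\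
  0 <= fine (\int[P]_w (f w)%:E)%E <= 1.
Proof.
move=> mf f01.
have f0 : (0 <= \int[P]_w (f w)%:E)%E.
  by apply: integral_ge0 => w _; rewrite lee_fin; case/andP: (f01 w).
have f1 : (\int[P]_w (f w)%:E <= 1)%E.
  rewrite -(probability_setT P) -[leRHS]mul1e -integral_cst//.
  apply: ge0_le_integral => //.
  - by move=> w _; rewrite lee_fin; case/andP: (f01 w).
  - exact/measurable_EFinP.
  - by move=> w _; rewrite lee_fin; case/andP: (f01 w).
have fin : (\int[P]_w (f w)%:E)%E \is a fin_num.
  by rewrite ge0_fin_numE// (le_lt_trans f1)// ltry.
by rewrite fineK//; split=> //; rewrite -!lee_fin fineK// f0.
Qed.

Let integral01_le f g (S : set T) (k m : R) : measurable S -> 0 <= k -> 0 <= m ->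
  measurable_fun setT f -> (forall w, 0 <= f w <= 1) ->
  measurable_fun setT g -> (forall w, 0 <= g w <= 1) ->
  (forall w, f w <= g w + (k + m * \1_S w)) ->
  fine (\int[P]_w (f w)%:E)%E <= fine (\int[P]_w (g w)%:E)%E + (k + m * pr P S).
Proof.
move=> mS k0 m0 mf f01 mg g01 fg.
have [fE _] := integral01 mf f01; have [gE _] := integral01 mg g01.
have mS1 : measurable_fun setT (fun w => m * \1_S w : R).
  by apply: measurable_funM => //; exact: measurable_indic.
have mkS : measurable_fun setT (fun w => k + m * \1_S w : R).
  exact: measurable_funD.
have S0 w : 0 <= m * \1_S w :> R by rewrite mulr_ge0.
rewrite -lee_fin -fE EFinD -gE.
have -> : ((k + m * pr P S)%:E = \int[P]_w (k + m * \1_S w)%:E)%E.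
  under eq_integral do rewrite EFinD.
  rewrite ge0_integralD//=; last 2 first.
  - by move=> w _; rewrite lee_fin.
  - exact/measurable_EFinP.
  rewrite integral_cst// [X in (_ * X)%E](probability_setT P) mule1.
  rewrite (integralZl_indic measurableT (fun=> S))//=; last first.
    by move=> /(le_lt_trans m0); rewrite ltxx.
  by rewrite integral_indic// setIT EFinD EFinM -prE.
rewrite -ge0_integralD//=; last 4 first.
- by move=> w _; rewrite lee_fin; case/andP: (g01 w).
- exact/measurable_EFinP.
- by move=> w _; rewrite lee_fin addr_ge0.
- exact/measurable_EFinP.
apply: ge0_le_integral => //.
- by move=> w _; rewrite lee_fin; case/andP: (f01 w).
- exact/measurable_EFinP.
- by apply: emeasurable_funD; exact/measurable_EFinP.
- by move=> w _; rewrite -EFinD lee_fin.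
Qed.

(** Turns closeness outside an event [S] of small probability into closeness of expectations;
    convergence in probability is used in this form. *)
Lemma integral01_dist f g (S : set T) (k m : R) : measurable S -> 0 <= k -> 0 <= m ->
  measurable_fun setT f -> (forall w, 0 <= f w <= 1) ->
  measurable_fun setT g -> (forall w, 0 <= g w <= 1) ->
  (forall w, `|f w - g w| <= k + m * \1_S w) ->
  `|fine (\int[P]_w (f w)%:E)%E - fine (\int[P]_w (g w)%:E)%E| <= k + m * pr P S.
Proof.
move=> mS k0 m0 mf f01 mg g01 fg.
rewrite ler_distl lerBlDr; apply/andP; split; apply: integral01_le => // w;
  have := fg w; rewrite ler_norml => /andP[]; lra.
Qed.

End expectation_distance.

(** * The joint limit law of the two maxima *)

Section switched_maximum.
Context (d : measure_display) (T : measurableType d) (R : realType)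
    (P : probability T R).
Variables (X X' eps : nat -> {RV P >-> R}) (lambda : {RV P >-> R})
    (a b : nat -> R) (G : cumulativeBounded (0 : R) (1 : R)).
Hypothesis Xstat : strictly_stationary X.
Hypothesis a_gt0 : forall n : nat, (0 < n)%N -> 0 < a n.
Hypothesis XD : forall x y : R,
       condD X (fun n => (a n)^-1 * x + b n) (fun n => (a n)^-1 * y + b n) /\
       condD' X (fun n => (a n)^-1 * x + b n).
Hypothesis Gnondeg : nondegenerate_df G.
Hypothesis FG : forall x : R, {for x, continuous (G : R -> R)} ->
       (cdf (X 0%N) ((a n)^-1 * x + b n) ^+ n)%E @[n --> \oo] --> (G x)%:E.
Hypothesis eps01 : forall (n : nat) (w : T), eps n w = 0 \/ eps n w = 1.
Hypothesis eps_indep : indep_seq eps X.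
Hypothesis lambda01 : {ae P, forall w : T, 0 <= lambda w <= 1}.
Hypothesis eps_lambda : cvg_in_probability P
       (fun n w => partial_sum (fun i => eps i) n w / n%:R) lambda.
Hypothesis X'_law : same_law X' X.
Hypothesis X'_indep : indep_seq_pair X' X eps.

Local Notation u := (fun n x => (a n)^-1 * x + b n).
Local Notation tail := (tail X).
Local Notation joint := (joint X X' eps).

Let FG_real x : {for x, continuous (G : R -> R)} ->
  (1 - tail (u n x)) ^+ n @[n --> \oo] --> G x.
Proof.
move=> /FG; under eq_fun do rewrite cdf_tail -EFin_expe.
exact: fine_cvg.
Qed.

Lemma limit_df_continuous x : {for x, continuous (G : R -> R)}.
Proof.
apply: (max_stable_continuous (F := fun r => 1 - tail r) _ _ a_gt0 FG_real) => //.
  by move=> r s rs; rewrite lerD2l lerN2 tail_nonincreasing.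
by move=> r; rewrite subr_ge0 tail_le1.
Qed.

Let tail_limit x : 0 < G x -> n%:R * tail (u n x) @[n --> \oo] --> - ln (G x).
Proof. by move=> Gx; apply: tail_cvg => //; exact/FG_real/limit_df_continuous. Qed.

Let u_min n x y : (0 < n)%N -> Num.min (u n x) (u n y) = u n (Num.min x y).
Proof.
move=> n0; have h : {homo (u n) : s t / s <= t}.
  by move=> s t; exact: norming_le.
case: (leP x y) => [/h xy|/ltW/h yx]; first exact: min_l.
exact: min_r.
Qed.

(** The limiting probability given a proportion [s] of ones: for [tm] and [tM] equal to minus [ln G]
    at the minimum and maximum of [x] and [y], it is [G(min) G(max)^(1 - s)]. *)
Let hlim (tm tM s : R) : R := expR (- (tm + (1 - s) * tM)).

Let frac n w : R := partial_sum (fun i => eps i) n w / n%:R.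

Let fracE n w : frac n w = #|ones eps n w|%:R / n%:R.
Proof. by rewrite /frac partial_sum_ones. Qed.

Let frac01 n w : 0 <= frac n w <= 1.
Proof.
rewrite fracE; case: n => [|n]; first by rewrite invr0 mulr0 lexx ler01.
rewrite divr_ge0//= ler_pdivrMr ?ltr0n// mul1r ler_nat.
by rewrite -[leqRHS]card_ord max_card.
Qed.

Let measurable_frac n : measurable_fun setT (frac n).
Proof.
apply: measurable_funM => //; rewrite /partial_sum.
by apply: measurable_sum => i.
Qed.

Let measurable_hlim tm tM (s : T -> R) : measurable_fun setT s ->
  measurable_fun setT (fun w => hlim tm tM (s w)).
Proof.
move=> ms; apply: (measurableT_comp (f := @expR R)) => //.
apply: (measurable_funN (f := fun w => tm + (1 - s w) * tM)).
apply: measurable_funD => //.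
by apply: measurable_funM => //; exact: measurable_funB.
Qed.

Let hlim01 tm tM s : 0 <= tm -> 0 <= tM -> 0 <= s <= 1 -> 0 <= hlim tm tM s <= 1.
Proof.
move=> tm0 tM0 /andP[s0 s1]; rewrite expR_ge0 expR_le1 oppr_le0.
by rewrite addr_ge0// mulr_ge0// subr_ge0.
Qed.

(* [lambda] lies in [0,1] only almost surely; clipping it makes the integrands
   below bounded everywhere. *)
Let lambda' w : R := Num.max 0 (Num.min 1 (lambda w)).

Let lambda'01 w : 0 <= lambda' w <= 1.
Proof. by rewrite /lambda' le_max lexx ge_max ler01 ge_min lexx. Qed.

Let measurable_lambda' : measurable_fun setT lambda'.
Proof. by apply: measurable_maxr => //; apply: measurable_minr. Qed.

(** Clipping to [0,1] never moves a point away from a point of [0,1]. *)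
Let lambda'_dist s w : 0 <= s <= 1 -> `|s - lambda' w| <= `|s - lambda w|.
Proof.
rewrite /lambda' => /andP[s0 s1].
case: (leP 1 (lambda w)) => [l1|l1].
  by rewrite max_r// !ler0_norm; lra.
case: (leP 0 (lambda w)) => [l0|l0]//.
by rewrite subr0 !ger0_norm; lra.
Qed.

(** * The case where [G] is positive at the smaller argument *)

Section positive_limit.
Variables x y : R.
Hypothesis Gxy : 0 < G (Num.min x y).
Let xm := Num.min x y.
Let xM := Num.max x y.
Let tm n := n%:R * tail (u n xm).
Let tM n := n%:R * tail (u n xM).
Let c : R := - ln (G xm).
Let e : R := - ln (G xM).

Let GxM : 0 < G xM.
Proof. by apply: lt_le_trans Gxy _; apply: df_mono; rewrite /xM le_max ge_min lexx. Qed.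

Let tm_cvg : tm n @[n --> \oo] --> c.
Proof. exact: tail_limit. Qed.

Let tM_cvg : tM n @[n --> \oo] --> e.
Proof. exact: tail_limit. Qed.

Let tm_ge0 n : 0 <= tm n. Proof. by rewrite mulr_ge0 ?tail_ge0. Qed.
Let tM_ge0 n : 0 <= tM n. Proof. by rewrite mulr_ge0 ?tail_ge0. Qed.

Let c_ge0 : 0 <= c.
Proof. by apply: (cvgr_to_ge tm_cvg); near=> n. Unshelve. all: by end_near. Qed.

Let e_ge0 : 0 <= e.
Proof. by apply: (cvgr_to_ge tM_cvg); near=> n. Unshelve. all: by end_near. Qed.

Let joint_near (dl : R) : 0 < dl -> \forall n \near \oo,
  `|pr P (joint n (u n x) (u n y)) -
    fine (\int[P]_w (hlim (tm n) (tM n) (frac n w))%:E)%E| <= dl.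
Proof.
move=> dl0; have dl2 : 0 < dl / 2 by rewrite divr_gt0.
have n_gt0 : \forall n \near \oo, (0 < n)%N by exists 1%N.
have xmy : Num.min xm y = xm by rewrite min_l// /xm ge_min lexx orbT.
have tmK : \forall n \near \oo, n%:R * tail (u n xm) <= c + 1.
  have : \forall n \near \oo, tm n < c + 1 by apply: (cvgr_lt _ tm_cvg); rewrite ltrDl.
  by apply: filterS => n /ltW.
have wE1 : \forall n \near \oo, u n xm = Num.min (u n xm) (u n y).
  by near=> n; rewrite u_min ?xmy//; near: n.
have wE2 : \forall n \near \oo, u n xm = Num.min (u n x) (u n y).
  by near=> n; rewrite u_min//; near: n.
have D' : condD' X (fun n => u n xm) by case: (XD xm xm).
(* The levels at [xm] and [y] serve the constraint on [X], those at [x] and [y] the constraint on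
   [X']; both pairs have minimum [u n xm]. *)
have near1 := below_asymptotics Xstat (XD xm y).1 D' wE1 tmK dl2.
have near2 := below_asymptotics Xstat (XD x y).1 D' wE2 tmK dl2.
apply: filterS (filterI (filterI n_gt0 near1) near2) => n [[n0 {}near1] {}near2].
have nR : n%:R != 0 :> R by rewrite pnatr_eq0 -lt0n.
pose f1 (A : {set 'I_n}) :=
  expR (- (#|A|%:R * tail (u n xm) + #|~: A|%:R * tail (u n y))).
pose f2 (A : {set 'I_n}) := expR (- (#|~: A|%:R * tail (u n x))).
have hE w : hlim (tm n) (tM n) (frac n w) = f1 (ones eps n w) * f2 (ones eps n w).
  rewrite /f1 /f2 -expRD /hlim fracE; congr expR.
  have -> : #|~: ones eps n w|%:R = n%:R - #|ones eps n w|%:R :> R.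
    by apply/eqP; rewrite eq_sym subr_eq -natrD addnC cardsC card_ord.
  (* The tails at [x] and [y] are those at [xm] and [xM] in some order, so off [A] the two exponents
     add up symmetrically. *)
  have -> : tail (u n x) = tail (u n xm) + tail (u n xM) - tail (u n y).
    by rewrite /xm /xM; case: leP => _; ring.
  by rewrite /tm /tM; field.
have h1 (A : {set 'I_n}) :
    `|pr P (below X A (Num.min (u n x) (u n y)) `&` below X (~: A) (u n y))
      - f1 A| <= dl / 2.
  by rewrite u_min//; exact: near1 (finset.setICr A).
have h2 (A : {set 'I_n}) : `|pr P (below X (~: A) (u n x)) - f2 A| <= dl / 2.
  rewrite (_ : f2 A = expR (- (#|~: A|%:R * tail (u n x) +
    #|(finset.set0 : {set 'I_n})|%:R * tail (u n y)))); last first.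
    by rewrite /f2 cards0 mul0r addr0.
  rewrite (_ : below X (~: A) (u n x) = below X (~: A) (u n x) `&`
    below X (finset.set0 : {set 'I_n}) (u n y)); last first.
    by apply/seteqP; split=> w; [move=> h; split=> // i; rewrite inE | case].
  exact: near2 (finset.setI0 _).
have f2_01 A : 0 <= f2 A <= 1.
  by rewrite /f2 expR_ge0 expR_le1 oppr_le0 mulr_ge0 ?tail_ge0.
have := joint_estimate eps01 eps_indep X'_law X'_indep
  (x := f1) (fun A => expR_ge0 _) f2_01 h1 h2.
under eq_integral do rewrite -hE.
have [-> _] := integral01 P (measurable_hlim (tm n) (tM n) (measurable_frac n))
  (fun w => hlim01 (tm_ge0 n) (tM_ge0 n) (frac01 n w)).
by rewrite -EFinB lee_fin (_ : 2 * (dl / 2) = dl)//; field.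
Unshelve. all: by end_near. Qed.

Let hlim_near (dl : R) : 0 < dl -> \forall n \near \oo,
  `|fine (\int[P]_w (hlim (tm n) (tM n) (frac n w))%:E)%E -
    fine (\int[P]_w (hlim c e (lambda' w))%:E)%E| <= dl.
Proof.
move=> dl0; have dl4 : 0 < dl / 4 by rewrite divr_gt0.
have e1 : 0 < e + 1 by rewrite ltr_wpDl.
(* Dividing by [e + 1] keeps [e * eta] below [dl / 4] even when [e] is 0. *)
pose eta : R := dl / 4 / (e + 1).
have eta0 : 0 < eta by rewrite divr_gt0.
have eeta : e * eta <= dl / 4.
  by rewrite /eta mulrA ler_pdivrMr// mulrC ler_wpM2l ?(ltW dl4)// lerDl.
pose S n := [set w | eta <= `|frac n w - lambda w|].
have mS n : measurable (S n).
  rewrite (_ : S n = (fun w => `|frac n w - lambda w|) @^-1` `[eta, +oo[); last first.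
    by apply/seteqP; split=> w; rewrite /S/= in_itv/= andbT.
  rewrite -[X in measurable X]setTI; apply: measurableT_comp => //.
  exact: measurable_funB.
have PS : \forall n \near \oo, pr P (S n) < eta.
  have : \forall n \near \oo, (P (S n) < eta%:E)%E.
    have eta0' : (0 < eta%:E)%E by rewrite lte_fin.
    have h : P (S n) @[n --> \oo] --> 0%E by exact: eps_lambda.
    exact: h _ (open_ereal_lt' eta0').
  by apply: filterS => n; rewrite prE.
have near_tm : \forall n \near \oo, `|c - tm n| <= dl / 4.
  by move/cvgrPdist_le: tm_cvg; exact.
have near_tM : \forall n \near \oo, `|e - tM n| <= dl / 4.
  by move/cvgrPdist_le: tM_cvg; exact.
apply: filterS (filterI (filterI PS near_tm) near_tM) => n [[PSn tmc] tMe].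
rewrite distrC in tmc; rewrite distrC in tMe.
have dist w : `|hlim (tm n) (tM n) (frac n w) - hlim c e (lambda' w)| <=
    (dl / 4 + dl / 4 + e * eta) + e * \1_(S n) w.
  have s01 := frac01 n w; have l01 := lambda'01 w.
  have /andP[s0 s1] := s01; have /andP[l0 l1] := l01.
  apply: (le_trans (expRN_lip _ _)).
  - by rewrite addr_ge0// mulr_ge0// subr_ge0.
  - by rewrite addr_ge0// mulr_ge0// subr_ge0.
  have -> : tm n + (1 - frac n w) * tM n - (c + (1 - lambda' w) * e) =
    (tm n - c) + (1 - frac n w) * (tM n - e) + (lambda' w - frac n w) * e by ring.
  have g1 : `|(1 - frac n w) * (tM n - e)| <= dl / 4.
    by rewrite normrM -[leRHS]mul1r ler_pM// ger0_norm ?subr_ge0// gerBl.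
  have g2 : `|(lambda' w - frac n w) * e| <= e * (eta + \1_(S n) w).
    rewrite normrM (ger0_norm e_ge0) mulrC ler_wpM2l// indicE.
    have [wS|wS] := pselect (S n w).
      rewrite mem_set//= mulr1n (@le_trans _ _ 1) ?lerDr ?(ltW eta0)//.
      by rewrite ler_norml; apply/andP; split; lra.
    rewrite memNset// addr0 distrC (le_trans (lambda'_dist _ s01))// leNgt.
    by apply/negP => /ltW.
  have := ler_normD (tm n - c + (1 - frac n w) * (tM n - e)) ((lambda' w - frac n w) * e).
  have := ler_normD (tm n - c) ((1 - frac n w) * (tM n - e)).
  lra.
have k0 : 0 <= dl / 4 + dl / 4 + e * eta.
  by rewrite !addr_ge0 ?(ltW dl4)// mulr_ge0// ltW.
have := integral01_dist P (mS n) k0 e_ge0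
  (measurable_hlim (tm n) (tM n) (measurable_frac n))
  (fun w => hlim01 (tm_ge0 n) (tM_ge0 n) (frac01 n w))
  (measurable_hlim c e measurable_lambda')
  (fun w => hlim01 c_ge0 e_ge0 (lambda'01 w)) dist.
have : e * pr P (S n) <= e * eta by rewrite ler_wpM2l// ltW.
lra.
Qed.

Let limitE : ((fine (\int[P]_w (hlim c e (lambda' w))%:E))%:E =
  (G xm)%:E * 'E_P[fun w => powR (G xM) (1 - lambda w)])%E.
Proof.
have [<- _] := integral01 P (measurable_hlim c e measurable_lambda')
  (fun w => hlim01 c_ge0 e_ge0 (lambda'01 w)).
have mpow (f : T -> R) : measurable_fun setT f ->
    measurable_fun setT (fun w => (powR (G xM) (1 - f w))%:E).
  move=> mf; apply/measurable_EFinP.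
  apply: (measurableT_comp (f := powR (G xM))); first exact: measurable_powRr.
  exact: measurable_funB.
have pow0 (f : T -> R) w : (0 <= (powR (G xM) (1 - f w))%:E)%E.
  by rewrite lee_fin powR_ge0.
rewrite unlock.
have -> : (\int[P]_w (powR (G xM) (1 - lambda w))%:E =
           \int[P]_w (powR (G xM) (1 - lambda' w))%:E)%E.
  apply: ge0_ae_eq_integral => //; [exact: mpow | exact: mpow |].
  apply: filterS lambda01 => w /andP[l0 l1] _.
  by rewrite /lambda' (min_r l1) (max_r l0).
rewrite -ge0_integralZl_EFin//; last 2 first.
- exact: mpow.
- exact: df_ge0.
apply: eq_integral => w _; rewrite -EFinM; congr EFin.
rewrite /hlim opprD expRD /c opprK lnK//; congr (_ * _).
by rewrite /powR gt_eqF// /e mulrN opprK.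
Qed.

Lemma joint_cvg : pr P (joint n (u n x) (u n y)) @[n --> \oo] -->
  fine ((G xm)%:E * 'E_P[fun w => powR (G xM) (1 - lambda w)])%E.
Proof.
rewrite -limitE/=; apply/cvgrPdist_le => dl dl0.
have dl2 : 0 < dl / 2 by rewrite divr_gt0.
apply: filterS (filterI (joint_near dl2) (hlim_near dl2)) => n [h1 h2].
rewrite distrC -(subrKA (fine (\int[P]_w (hlim (tm n) (tM n) (frac n w))%:E)%E)).
apply: (le_trans (ler_normD _ _)); lra.
Qed.

Lemma joint_limit_fin :
  ((G xm)%:E * 'E_P[fun w => powR (G xM) (1 - lambda w)])%E \is a fin_num.
Proof. by rewrite -limitE. Qed.

(** Serves the case where [G] vanishes at the smaller argument, by comparison with levels at which
    this limit is small. *)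
Lemma joint_limit_le :
  fine ((G xm)%:E * 'E_P[fun w => powR (G xM) (1 - lambda w)])%E <= G xm.
Proof.
rewrite -limitE/=.
have hl := measurable_hlim c e measurable_lambda'.
have h01 w := hlim01 c_ge0 e_ge0 (lambda'01 w).
have [hE _] := integral01 P hl h01.
rewrite -lee_fin -hE -[leRHS]mule1 -(probability_setT P) -integral_cst//.
apply: ge0_le_integral => //=.
- by move=> w _; rewrite lee_fin; case/andP: (h01 w).
- exact/measurable_EFinP.
- move=> w _; rewrite lee_fin -[leRHS]lnK// -[ln _]opprK ler_expR lerN2 lerDl.
  by rewrite mulr_ge0// subr_ge0; case/andP: (lambda'01 w).
Qed.

End positive_limit.

(** Continuity of [G] gives [z] with [0 < G z < e]. Raising both arguments to at least [z] makes
    their minimum equal to [z], enlarges the event, and gives it a limit below [e]. *)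
Let joint_cvg0 x y : G (Num.min x y) = 0 ->
  pr P (joint n (u n x) (u n y)) @[n --> \oo] --> (0 : R).
Proof.
move=> G0; apply/cvgrPdist_le => e e0.
have [z Gz0 Gze] : exists2 z, 0 < G z & G z < e.
  pose m : R := Num.min e 1 / 2.
  have m0 : 0 < m by rewrite divr_gt0// lt_min e0 ltr01.
  have m1 : m < 1 by rewrite ltr_pdivrMr// mul1r gt_min; apply/orP; right; lra.
  have me : m < e by rewrite ltr_pdivrMr// gt_min; apply/orP; left; lra.
  have [z1 Gz1] := df_ex_gt G m1.
  have xz1 : Num.min x y <= z1 by apply/ltW/(df_lt (G := G)); rewrite G0 (lt_trans m0).
  have [z _ Gz] : exists2 z, z \in `[Num.min x y, z1] & G z = m.
    apply: IVT => //; first exact/continuous_subspaceT/limit_df_continuous.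
    by rewrite G0 ge_min (ltW m0) le_max (ltW Gz1) orbT.
  by exists z; rewrite Gz.
have xyz : Num.min x y <= z by apply/ltW/(df_lt (G := G)); rewrite G0.
have minE : Num.min (Num.max x z) (Num.max y z) = z by rewrite -max_minl max_r.
have Gpos : 0 < G (Num.min (Num.max x z) (Num.max y z)) by rewrite minE.
have lim_e := le_lt_trans (joint_limit_le Gpos)
  (etrans (congr1 (fun t => G t < e) minE) Gze).
have near_e : \forall n \near \oo,
    pr P (joint n (u n (Num.max x z)) (u n (Num.max y z))) < e.
  exact: (cvgr_lt _ (joint_cvg Gpos)).
have n_gt0 : \forall n \near \oo, (0 < n)%N by exists 1%N.
apply: filterS (filterI n_gt0 near_e) => n [n0 /ltW]; apply: le_trans.
rewrite sub0r normrN ger0_norm ?pr_ge0//.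
apply: le_pr; [exact: measurable_joint..|].
by move=> w h i; case: (h i) => h1 h2; split;
  [apply: le_trans h1 _ | apply: le_trans h2 _]; apply: norming_le;
  rewrite // le_max lexx.
Qed.

Lemma joint_limit x y :
  P [set w | running_max (switched eps X X') n w <= u n x /\
             running_max (fun i => X i) n w <= u n y]
    @[n --> \oo] -->
  ((G (Num.min x y))%:E *
   'E_P[fun w => powR (G (Num.max x y)) (1 - lambda w)])%E.
Proof.
have n_gt0 : \forall n \near \oo, (0 < n)%N by exists 1%N.
apply: (@cvg_trans _ ((pr P (joint n (u n x) (u n y)))%:E @[n --> \oo])).
  apply: near_eq_cvg; apply: filterS n_gt0 => n n0.
  by rewrite joint_running_max// prE//; exact: measurable_joint.
have := df_ge0 G (Num.min x y); rewrite le_eqVlt => /orP[/eqP G0|Gpos].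
  by rewrite -G0 mul0e; apply: cvg_EFin; [exact: nearW | exact: joint_cvg0].
rewrite -(fineK (joint_limit_fin Gpos)); apply: cvg_EFin; first exact: nearW.
exact: joint_cvg.
Qed.

End switched_maximum.

Theorem theorem2p1 (d : measure_display) (T : measurableType d) (R : realType)
    (P : probability T R)
    (X X' eps : nat -> {RV P >-> R}) (lambda : {RV P >-> R})
    (a b : nat -> R) (G : cumulativeBounded (0 : R) (1 : R))
    (Xstat : strictly_stationary X)
    (a_gt0 : forall n : nat, (0 < n)%N -> 0 < a n)
    (XD : forall x y : R,
       condD X (fun n => (a n)^-1 * x + b n) (fun n => (a n)^-1 * y + b n) /\
       condD' X (fun n => (a n)^-1 * x + b n))
    (Gnondeg : nondegenerate_df G)
    (FG : forall x : R, {for x, continuous (G : R -> R)} ->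
       (cdf (X 0%N) ((a n)^-1 * x + b n) ^+ n)%E @[n --> \oo] --> (G x)%:E)
    (eps01 : forall (n : nat) (w : T), eps n w = 0 \/ eps n w = 1)
    (eps_indep : indep_seq eps X)
    (lambda01 : {ae P, forall w : T, 0 <= lambda w <= 1})
    (eps_lambda : cvg_in_probability P
       (fun n w => partial_sum (fun i => eps i) n w / n%:R) lambda)
    (X'_law : same_law X' X)
    (X'_indep : indep_seq_pair X' X eps)
    (x y : R) :
  P [set w | running_max (switched eps X X') n w <= (a n)^-1 * x + b n /\
             running_max (fun i => X i) n w <= (a n)^-1 * y + b n]
    @[n --> \oo] -->
  ((G (Num.min x y))%:E *
   'E_P[fun w => powR (G (Num.max x y)) (1 - lambda w)])%E.
Proof.
exact: joint_limit.
Qed.
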